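(* There exists a radial triangle-square flat $F$ such that for every $k>0$ there are Gersten-Short geodesics $\alpha$ and $\beta$ in $F$ whose start vertices are joined by an edge and whose end vertices are joined by an edge, but such that the subspace distance between $\alpha$ and $\beta$ is larger than $k$. In particular, there are radial flat planes in which the Gersten-Short geodesics that start and end at most $1$ unit apart do not synchronously $k$-fellow travel for any value of $k$.
   Context: A triangle-square complex is a $2$-complex obtained by gluing unit equilateral triangles and unit squares by isometric identifications of their faces. A triangle-square flat $F$ is a triangle-square complex isometric to the Euclidean plane $\mathbb{R}^2$ (hence $\mathrm{CAT}(0)$). A region of $F$ is the union of the closed $2$-cells in an equivalence class of the equivalence relation on $2$-cells generated by relating two $2$-cells of the same type (triangle/square) that share an edge. A corner vertex is a vertex touching exactly $3$ triangles and $2$ squares in which the two squares are not adjacent around the vertex. $F$ is radial if it contains a corner vertex and at least one unbounded region. Paths are edge paths; $d$ is the $1$-skeleton metric with unit edges; a geodesic is a shortest edge path between its endpoints. For vertices $u,v$, the interval $F[u,v]$ is the full subcomplex on the vertices $w$ with $d(u,w)+d(w,v)=d(u,v)$. Length-preserving moves are given by the following disc diagrams, each with a start vertex, an end vertex and two boundary paths (''sides'') of equal length from start to end: (i) a single square, with opposite vertices as start and end; (ii) two triangles sharing an edge, start and end being the vertices not on that edge; (iii) a finite row of $n\geq1$ squares $[0,n]\times[0,1]$ with a triangle glued on each of the edges $\{0\}\times[0,1]$ and $\{n\}\times[0,1]$, start and end being the two triangle vertices not on the row. Such a move in the interval starting at $u$ is one mapped cellularly into it with start vertex at $u$ and converting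 one geodesic from $u$ to $v$ into another by replacing one side with the other. Gersten-Short geodesics from $u$ to $v$ are defined inductively. If $u=v$ it is the trivial path. If $u\ne v$, it is known that exactly one of the following holds: (a) all geodesics from $u$ to $v$ have the same first edge; then the Gersten-Short geodesic begins with this edge, to its other endpoint $u'$; (b) there are exactly two possible first edges and a unique length-preserving move in $F[u,v]$ starting at $u$ containing both of them; then the Gersten-Short geodesic begins by travelling along either side of this move to its end vertex $u'$. In both cases it continues with a Gersten-Short geodesic from $u'$ to $v$. For paths $\alpha,\beta$ in the $1$-skeleton, the subspace distance is the smallest $k$ such that each is contained in the $k$-neighborhood of the other. With $\alpha(t)$ denoting the point $t$ units along $\alpha$ (the start for $t<0$, the end for $t>|\alpha|$, where $|\alpha|$ is the length of $\alpha$), they synchronously $k$-fellow travel if $d(\alpha(t),\beta(t))\le k$ for all real $t$. *)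

(* Defs.v *)
From Stdlib Require Import Reals List Relations.
From Coquelicot Require Export Rbar Lub.
Import ListNotations.
Set Implicit Arguments.
Local Open Scope R_scope.

(** * Model cells *)

Definition R2 : Type := (R * R)%type.

Definition eucl (x y : R2) : R := dist_euc (fst x) (snd x) (fst y) (snd y).

Definition lerp (a b : R2) (s : R) : R2 :=
  ((1 - s) * fst a + s * fst b, (1 - s) * snd a + s * snd b).

Inductive kind : Type := Triangle | Square.

(** Corners in cyclic (counterclockwise) order. *)
Definition model_corners (k : kind) : list R2 :=
  match k with
  | Triangle => [(0, 0); (1, 0); (1 / 2, sqrt 3 / 2)]
  | Square => [(0, 0); (1, 0); (1, 1); (0, 1)]
  end.

Definition polygon (k : kind) (x : R2) : Prop :=
  match k with
  | Triangle => 0 <= snd x /\ snd x <= sqrt 3 * fst x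
                /\ snd x <= sqrt 3 * (1 - fst x)
  | Square => 0 <= fst x <= 1 /\ 0 <= snd x <= 1
  end.

Definition cyclic_pairs (A : Type) (l : list A) : list (A * A) :=
  match l with
  | [] => []
  | x :: l' => combine l (l' ++ [x])
  end.

(** Sides with either orientation. *)
Definition side (k : kind) (a b : R2) : Prop :=
  In (a, b) (cyclic_pairs (model_corners k)) \/
  In (b, a) (cyclic_pairs (model_corners k)).

Definition segment (a b x : R2) : Prop :=
  exists s, 0 <= s <= 1 /\ x = lerp a b s.

Inductive proper_face (k : kind) : (R2 -> Prop) -> Prop :=
| face_corner a : In a (model_corners k) -> proper_face k (eq a)
| face_side a b : side k a b -> proper_face k (segment a b).

Definition face_isometry (h : R2 -> R2) (A B : R2 -> Prop) : Prop :=
  (forall x, A x -> B (h x)) /\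
  (forall y, B y -> exists x, A x /\ h x = y) /\
  (forall x x', A x -> A x' -> eucl (h x) (h x') = eucl x x').

(** * Triangle-square complexes *)

(** The quotient of a disjoint union of model cells is given by its set of
    points and the characteristic maps of the cells, [char c] being meaningful
    only on [polygon (shape c)].  By [char_glue], two distinct points of the
    disjoint union are identified only through an isometry between a proper
    face of one cell and a proper face of the other that is respected by the
    whole gluing. *)
Record ts_complex : Type := {
  point : Type;
  cell : Type;
  shape : cell -> kind;
  char : cell -> R2 -> point;
  char_surj : forall p, exists c x, polygon (shape c) x /\ char c x = p;
  char_glue : forall c c' x x',
    polygon (shape c) x -> polygon (shape c') x' -> char c x = char c' x' ->
    (c = c' /\ x = x') \/
    exists A A' h,
      proper_face (shape c) A /\ proper_face (shape c') A' /\
      face_isometry h A A' /\ A x /\ h x = x' /\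
      (forall y, A y -> char c y = char c' (h y))
}.

Arguments shape {_} _.
Arguments char {_} _ _.

(** [chain piece p q l]: [q] is reached from [p] by finitely many straight
    jumps of total length [l], [piece] being the allowed jumps. *)
Inductive chain (P : Type) (piece : P -> P -> R -> Prop) : P -> P -> R -> Prop :=
| chain_nil p : chain piece p p 0
| chain_cons p q r a b :
    piece p q a -> chain piece q r b -> chain piece p r (a + b).

Section Complex.

Variable F : ts_complex.

Definition within_cell (p q : point F) (a : R) : Prop :=
  exists (c : cell F) x y,
    polygon (shape c) x /\ polygon (shape c) y /\
    p = char c x /\ q = char c y /\ a = eucl x y.

Definition within_edge (p q : point F) (a : R) : Prop :=
  exists (c : cell F) e1 e2 x y,
    side (shape c) e1 e2 /\ segment e1 e2 x /\ segment e1 e2 y /\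
    p = char c x /\ q = char c y /\ a = eucl x y.

(** The quotient (path) metric of the complex, and the path metric of its
    1-skeleton; the infimum is [p_infty] when there is no chain. *)
Definition dist2 (p q : point F) : Rbar := Glb_Rbar (chain within_cell p q).
Definition d (p q : point F) : Rbar := Glb_Rbar (chain within_edge p q).

Definition flat : Prop :=
  exists f : point F -> R2,
    (forall p q, f p = f q -> p = q) /\
    (forall x, exists p, f p = x) /\
    (forall p q, dist2 p q = Finite (eucl (f p) (f q))).

Definition corners (c : cell F) : list (point F) :=
  map (char c) (model_corners (shape c)).

Definition vertex (p : point F) : Prop := exists c, In p (corners c).

(** The point at distance [s] from [u] on an edge from [u] to [v]. *)
Definition on_edge (u v : point F) (s : R) (p : point F) : Prop :=
  exists (c : cell F) a b, side (shape c) a b /\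
    u = char c a /\ v = char c b /\ p = char c (lerp a b s).

Definition adjacent (u v : point F) : Prop :=
  exists (c : cell F) a b, side (shape c) a b /\ u = char c a /\ v = char c b.

(** [c] and [c'] have a common edge, one endpoint of which is [u]. *)
Definition share_edge_at (u : point F) (c c' : cell F) : Prop :=
  exists a b a' b',
    side (shape c) a b /\ side (shape c') a' b' /\ char c a = u /\
    (forall s, 0 <= s <= 1 -> char c (lerp a b s) = char c' (lerp a' b' s)).

Definition share_edge (c c' : cell F) : Prop := exists u, share_edge_at u c c'.

(** * Radial flats *)

Definition same_region : cell F -> cell F -> Prop :=
  clos_refl_sym_trans (cell F)
    (fun c c' => shape c = shape c' /\ share_edge c c').

(** The region of the 2-cell [c]. *)
Definition region (c : cell F) (p : point F) : Prop :=
  exists c' x, same_region c c' /\ polygon (shape c') x /\ p = char c' x.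

Definition unbounded (A : point F -> Prop) : Prop :=
  forall M : R, exists p q, A p /\ A q /\ Rbar_lt M (dist2 p q).

Definition corner_vertex (p : point F) : Prop :=
  exists T S : list (cell F),
    NoDup T /\ length T = 3%nat /\ NoDup S /\ length S = 2%nat /\
    (forall c, In c T <-> shape c = Triangle /\ In p (corners c)) /\
    (forall c, In c S <-> shape c = Square /\ In p (corners c)) /\
    (forall c c', In c S -> In c' S -> c <> c' -> ~ share_edge_at p c c').

Definition radial : Prop :=
  (exists p, corner_vertex p) /\ (exists c, unbounded (region c)).

(** * Geodesics and intervals *)

(** An edge path is given by its nonempty list of vertices: in a flat, the
    edges are straight unit segments, so an edge is determined by its
    endpoints. *)
Inductive edge_path : point F -> list (point F) -> point F -> Prop :=
| path_nil u : vertex u -> edge_path u [u] u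
| path_cons u w v l :
    adjacent u w -> edge_path w l v -> edge_path u (u :: l) v.

Definition path_length (l : list (point F)) : nat := pred (length l).

Definition geodesic (u : point F) (l : list (point F)) (v : point F) : Prop :=
  edge_path u l v /\
  forall l', edge_path u l' v -> (path_length l <= path_length l')%nat.

(** The vertices of the interval; being a full subcomplex, the interval
    contains a cell if and only if it contains all the vertices of the cell. *)
Definition in_interval (u v w : point F) : Prop :=
  vertex w /\ Rbar_plus (d u w) (d w v) = d u v.

(** * Length-preserving moves *)

Definition rotation (A : Type) (l l' : list A) : Prop :=
  exists l1 l2, l = l1 ++ l2 /\ l' = l2 ++ l1.

(** Some 2-cell of kind [k] has boundary cycle [l], read from any corner and
    in either direction. *)
Definition spans (k : kind) (l : list (point F)) : Prop :=
  exists c : cell F, shape c = k /\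
    (rotation (corners c) l \/ rotation (rev (corners c)) l).

(** [move a e s1 s2]: the image in [F] of one of the three kinds of diagrams,
    with start [a], end [e] and sides [s1] and [s2].  All the vertices of the
    diagrams lie on their sides.  In [move_row] the bottom and top vertices of
    the row [[0,n] x [0,1]] are [x 0, ..., x n] and [y 0, ..., y n]. *)
Inductive move :
  point F -> point F -> list (point F) -> list (point F) -> Prop :=
| move_square a b e b' :
    spans Square [a; b; e; b'] -> move a e [a; b; e] [a; b'; e]
| move_triangles a b e b' :
    spans Triangle [a; b; b'] -> spans Triangle [b; e; b'] ->
    move a e [a; b; e] [a; b'; e]
| move_row a e (n : nat) (x y : nat -> point F) :
    (1 <= n)%nat ->
    spans Triangle [a; x 0%nat; y 0%nat] ->
    (forall i, (i < n)%nat -> spans Square [x i; x (S i); y (S i); y i]) ->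
    spans Triangle [x n; e; y n] ->
    move a e (a :: map x (seq 0 (S n)) ++ [e]) (a :: map y (seq 0 (S n)) ++ [e]).

(** A move in the interval from [u] to [v] starting at [u]. *)
Definition interval_move (u v e : point F) (s1 s2 : list (point F)) : Prop :=
  move u e s1 s2 /\
  Forall (in_interval u v) (s1 ++ s2) /\
  exists l, geodesic u (s1 ++ l) v /\ geodesic u (s2 ++ l) v.

(** * Gersten-Short geodesics *)

Definition first_edge (u v w : point F) : Prop :=
  exists l, geodesic u (u :: w :: l) v.

Definition begins (u w : point F) (s : list (point F)) : Prop :=
  exists l, s = u :: w :: l.

(** An interval move containing the edges from [u] to [w1] and to [w2], the
    sides being ordered accordingly. *)
Definition move_through (u v w1 w2 e : point F) (s1 s2 : list (point F)) : Prop :=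
  interval_move u v e s1 s2 /\ begins u w1 s1 /\ begins u w2 s2.

Inductive gersten_short : point F -> list (point F) -> point F -> Prop :=
| gs_trivial u : vertex u -> gersten_short u [u] u
| gs_edge u v u' l :
    u <> v ->
    (forall w, first_edge u v w <-> w = u') ->
    gersten_short u' l v ->
    gersten_short u (u :: l) v
| gs_move u v w1 w2 u' s1 s2 s l :
    u <> v ->
    w1 <> w2 ->
    (forall w, first_edge u v w <-> w = w1 \/ w = w2) ->
    move_through u v w1 w2 u' s1 s2 ->
    (forall e t1 t2, move_through u v w1 w2 e t1 t2 ->
       e = u' /\ t1 = s1 /\ t2 = s2) ->
    s = s1 \/ s = s2 ->
    gersten_short u' l v ->
    gersten_short u (s ++ tl l) v.

(** * Comparing paths *)

(** [at_time l t p]: [p] is the point [t] units along the path [l]. *)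
Definition at_time (l : list (point F)) (t : R) (p : point F) : Prop :=
  (t <= 0 /\ nth_error l 0 = Some p) \/
  (INR (path_length l) <= t /\ nth_error l (path_length l) = Some p) \/
  exists i s u v,
    t = INR i + s /\ 0 <= s <= 1 /\
    nth_error l i = Some u /\ nth_error l (S i) = Some v /\ on_edge u v s p.

Definition on_path (l : list (point F)) (p : point F) : Prop :=
  exists t, at_time l t p.

Definition within_nbhd (k : R) (A B : point F -> Prop) : Prop :=
  forall p, A p -> exists q, B q /\ Rbar_le (d p q) k.

Definition close (l l' : list (point F)) (k : R) : Prop :=
  within_nbhd k (on_path l) (on_path l') /\
  within_nbhd k (on_path l') (on_path l).

Definition subspace_distance (l l' : list (point F)) (k : R) : Prop :=
  close l l' k /\ forall k', close l l' k' -> k <= k'.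

Definition fellow_travel (k : R) (l l' : list (point F)) : Prop :=
  forall t p q, at_time l t p -> at_time l' t q -> Rbar_le (d p q) k.

End Complex.

(* Main.v *)
Require Import Defs.
From Stdlib Require Import Reals List.
From Coquelicot Require Import Rbar.
From Stdlib Require Import Relations ZArith Lra Lia ClassicalEpsilon.
From Coquelicot Require Import Rcomplements Lub.
Import ListNotations.
Local Open Scope R_scope.

(** The flat consists of four sectors around the origin, bounded by the rays of
    polar angles 0, 60, 150 and 270 degrees and tiled in turn by triangles, squares,
    triangles and squares.  The origin is a corner vertex, with one triangle in the
    first sector and two in the third, and the sectors are unbounded regions.

    Paths from below the corner to the second square sector may pass the corner on
    either side at the same cost.  Write [e_t] for the unit vector of polar angle
    [t].  From [(1, -m)] to [e_60 + m e_150] a geodesic may only go up to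
    [(1, 0)], cross the triangle at the origin to [e_60], and continue in direction
    150: each first edge is forced, so this is the Gersten-Short geodesic, and it
    passes next to the corner.  From the adjacent vertex [(0, -m)] to the adjacent
    vertex [m e_150], every path taking [m] edges of each of the directions 90 and
    150 through the triangles of the third sector is a geodesic.  Here both
    directions are always allowed until the end, so a Gersten-Short geodesic crosses
    [m] rhombi made of two triangles and stays close to the straight segment between
    its ends, which is at distance about [m / 2] from [(1, 0)].

    Lower bounds on distances come from potentials: functions that are linear on
    each sector, determined by their slopes on the four rays, and vary by at most 1
    along an edge ([slow]).  A path along which a slow potential falls by 1 at each
    edge is a geodesic ([steep_geodesic]), and an edge along which some slow potential
    falling along the known geodesic does not fall cannot be a first edge
    ([first_edge_bound]).  Two potentials settle all first edges ([climb_gs],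
    [zigzag_gs]); a third one separates [(1, 0)] from the second geodesic
    ([turn_far_from_zigzag]).

    For the complex itself, the gluing condition rests on the fact that the corner
    or side of a tile carrying a given point can be read off the sector coordinates
    of the point ([tiles_overlap]), and the quotient metric is Euclidean because a
    segment meets finitely many tiles, each in a subsegment ([straight_chain]).  The
    subspace distance is attained because distances are Lipschitz along edges, so a
    point has a nearest point on any path ([subspace_distance_exists]). *)

(** * Coordinates in the four sectors *)

Lemma sqrt3_sq : sqrt 3 * sqrt 3 = 3.
Proof. apply sqrt_sqrt; lra. Qed.

Lemma sqrt3_bounds : 17 / 10 <= sqrt 3 <= 18 / 10.
Proof.
pose proof sqrt3_sq; pose proof (sqrt_pos 3); split; nra.
Qed.

(** The rays are named by their polar angle in degrees.  A ray also stands for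
    the sector that it opens, which ends at the ray [next k]: the sectors at
    [E0] and [E150], of angles 60 and 120, are to be tiled by triangles, and
    the two right-angled ones by squares. *)
Inductive ray := E0 | E60 | E150 | E270.

Definition ray_dec (r r' : ray) : {r = r'} + {r <> r'}.
Proof. decide equality. Defined.

Definition next (k : ray) : ray :=
  match k with E0 => E60 | E60 => E150 | E150 => E270 | E270 => E0 end.

Definition vec (k : ray) : R2 :=
  match k with
  | E0 => (1, 0)
  | E60 => (1 / 2, sqrt 3 / 2)
  | E150 => (- (sqrt 3 / 2), 1 / 2)
  | E270 => (0, -1)
  end.

Definition pt (k : ray) (x : R2) : R2 :=
  (fst x * fst (vec k) + snd x * fst (vec (next k)),
   fst x * snd (vec k) + snd x * snd (vec (next k))).

Definition quadrant (x : R2) : Prop := 0 <= fst x /\ 0 <= snd x.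

(** All four coordinates of the point of sector [k] with coordinates [x]: each
    point is a combination of the two rays of a sector containing it, the other
    rays having coefficient 0.  Unlike [x], this does not depend on the choice
    of the sector when the point is on a ray, by [coord_unique]. *)
Definition coord (k : ray) (x : R2) (r : ray) : R :=
  if ray_dec r k then fst x else if ray_dec r (next k) then snd x else 0.

Lemma scaled_sqrt3 (s : R) :
  0 <= s -> 17 / 10 * s <= sqrt 3 * s <= 18 / 10 * s /\
  sqrt 3 * (sqrt 3 * s) = 3 * s.
Proof.
intros Hs; pose proof sqrt3_bounds; pose proof sqrt3_sq; split; [nra|].
rewrite <- Rmult_assoc, H0; ring.
Qed.

(** Two sectors meet only along a common ray, where the coordinates agree.
    Comparing abscissas and ordinates, each also multiplied by [sqrt 3], gives
    four equations linear in the coordinates and their products with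
    [sqrt 3]; the rational bounds on [sqrt 3] then settle every pair of
    sectors. *)
Lemma coord_unique (k l : ray) (x y : R2) (r : ray) :
  quadrant x -> quadrant y -> pt k x = pt l y -> coord k x r = coord l y r.
Proof.
destruct x as [s t], y as [s' t']; intros [Hs Ht] [Hs' Ht'] E; cbn [fst snd] in *.
destruct (scaled_sqrt3 s Hs) as [As Bs], (scaled_sqrt3 t Ht) as [At Bt].
destruct (scaled_sqrt3 s' Hs') as [As' Bs'], (scaled_sqrt3 t' Ht') as [At' Bt'].
unfold pt in E.
pose proof (f_equal fst E) as E1; pose proof (f_equal snd E) as E2.
pose proof (f_equal (Rmult (sqrt 3)) E1) as E3.
pose proof (f_equal (Rmult (sqrt 3)) E2) as E4.
clear E.
destruct k, l; cbn in *; destruct r; cbn; lra.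
Qed.

Lemma pt_inj (k : ray) (x y : R2) :
  quadrant x -> quadrant y -> pt k x = pt k y -> x = y.
Proof.
intros Hx Hy E.
pose proof (coord_unique k k x y k Hx Hy E) as E1.
pose proof (coord_unique k k x y (next k) Hx Hy E) as E2.
destruct x, y; destruct k; cbn in *; congruence.
Qed.

(** The bounds serve to select finitely many tiles near a given point. *)
Lemma sectors_cover (z : R2) :
  exists k x, quadrant x /\ z = pt k x /\
    fst x <= 2 * (Rabs (fst z) + Rabs (snd z)) /\
    snd x <= 2 * (Rabs (fst z) + Rabs (snd z)).
Proof.
destruct z as [a b]; cbn [fst snd].
pose proof sqrt3_sq as Hq; pose proof sqrt3_bounds as Hb.
set (q := sqrt 3) in *.
pose proof (Rle_abs a); pose proof (Rle_abs b).
pose proof (Rle_abs (- a)) as Ha'; pose proof (Rle_abs (- b)) as Hb'.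
rewrite Rabs_Ropp in Ha', Hb'.
assert (Qa : q * a <= 18/10 * Rabs a /\ - (q * a) <= 18 / 10 * Rabs a) by (split; nra).
assert (Qb : q * b <= 18/10 * Rabs b /\ - (q * b) <= 18 / 10 * Rabs b) by (split; nra).
assert (QQa : q * (q * a) = 3 * a) by nra.
assert (QQb : q * (q * b) = 3 * b) by nra.
destruct (Rle_dec 0 a) as [a0|a0], (Rle_dec b 0) as [b0|b0].
1: { exists E270, (- b, a); unfold quadrant, pt; cbn; fold q.
     repeat split; try lra; f_equal; lra. }
all: destruct (Rle_dec 0 (a + q * b)) as [c0|c0];
     destruct (Rle_dec b (q * a)) as [d0|d0]; try (exfalso; nra).
all: try (exists E0, (a - q * b / 3, 2 * q * b / 3); unfold quadrant, pt; cbn; fold q;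
     repeat split; try nra; f_equal; nra).
all: try (exists E60, ((a + q * b) / 2, (b - q * a) / 2); unfold quadrant, pt; cbn; fold q;
     repeat split; try nra; f_equal; nra).
all: exists E150, (- (2 * q * a / 3), - (q * a) / 3 - b); unfold quadrant, pt; cbn; fold q;
     repeat split; try nra; f_equal; nra.
Qed.

(** * Tiles *)

(** The unit parallelogram of a sector with lower corner of coordinates
    [(i, j)] is a square in the right-angled sectors.  In the other two it is
    made of a lower and an upper triangle, cut along the short diagonal: that is
    the diagonal of direction [(1, -1)] in the sector of angle 60, but of
    direction [(1, 1)] in the sector of angle 120. *)
Inductive tile :=
| sq60 (i j : nat) | sq270 (i j : nat)
| lo0 (i j : nat) | up0 (i j : nat)
| lo150 (i j : nat) | up150 (i j : nat).

Definition tile_kind (c : tile) : kind :=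
  match c with sq60 _ _ | sq270 _ _ => Square | _ => Triangle end.

Definition sector (c : tile) : ray :=
  match c with
  | sq60 _ _ => E60 | sq270 _ _ => E270
  | lo0 _ _ | up0 _ _ => E0
  | lo150 _ _ | up150 _ _ => E150
  end.

(** Sector coordinates of the first corner of the tile and of the two edges
    leaving it, in counterclockwise order. *)
Definition frame (c : tile) : R2 * (R2 * R2) :=
  match c with
  | sq60 i j | sq270 i j | lo0 i j => ((INR i, INR j), ((1, 0), (0, 1)))
  | up0 i j => ((INR i + 1, INR j + 1), ((-1, 0), (0, -1)))
  | lo150 i j => ((INR i, INR j), ((1, 0), (1, 1)))
  | up150 i j => ((INR i, INR j), ((1, 1), (0, 1)))
  end.

(** Coordinates of a point of the model cell along the edges at its first corner. *)
Definition bary (k : kind) (x : R2) : R2 :=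
  match k with
  | Square => x
  | Triangle => (fst x - sqrt 3 / 3 * snd x, 2 * sqrt 3 / 3 * snd x)
  end.

Definition local (c : tile) (x : R2) : R2 :=
  let '(o, (a, b)) := frame c in
  let y := bary (tile_kind c) x in
  (fst o + fst y * fst a + snd y * fst b, snd o + fst y * snd a + snd y * snd b).

Definition place (c : tile) (x : R2) : R2 := pt (sector c) (local c x).

Lemma lerp_0 (a b : R2) : lerp a b 0 = a.
Proof. destruct a, b; unfold lerp; cbn; f_equal; ring. Qed.

Lemma lerp_1 (a b : R2) : lerp a b 1 = b.
Proof. destruct a, b; unfold lerp; cbn; f_equal; ring. Qed.

Lemma pt_lerp k x y s : pt k (lerp x y s) = lerp (pt k x) (pt k y) s.
Proof. unfold pt, lerp; cbn; f_equal; ring. Qed.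

Lemma local_lerp c x y s : local c (lerp x y s) = lerp (local c x) (local c y) s.
Proof. destruct c; unfold local, lerp; cbn; f_equal; ring. Qed.

Lemma place_lerp c x y s : place c (lerp x y s) = lerp (place c x) (place c y) s.
Proof. unfold place; now rewrite local_lerp, pt_lerp. Qed.

Lemma place_isometry c x y : eucl (place c x) (place c y) = eucl x y.
Proof.
pose proof sqrt3_sq as H.
unfold eucl, dist_euc, Rsqr; f_equal.
destruct c, x, y; unfold place, pt, local; cbn; field [H].
Qed.

Definition displacement (x y : R2) : R2 := (fst y - fst x, snd y - snd x).
Definition dot (x y : R2) : R := fst x * fst y + snd x * snd y.

(** The inverse of the isometry [place c]; it is affine, which makes the trace of
    a tile on a line an intersection of half-lines. *)
Definition unplace (c : tile) (z : R2) : R2 :=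
  let o := place c (0, 0) in
  (dot (displacement o z) (displacement o (place c (1, 0))),
   dot (displacement o z) (displacement o (place c (0, 1)))).

Lemma place_unplace c z : place c (unplace c z) = z.
Proof.
pose proof sqrt3_sq as H.
destruct c, z; unfold place, unplace, dot, displacement, place, pt, local; cbn;
  f_equal; field [H].
Qed.

Lemma unplace_place c x : unplace c (place c x) = x.
Proof.
pose proof sqrt3_sq as H.
destruct c, x; unfold unplace, dot, displacement, place, pt, local; cbn;
  f_equal; field [H].
Qed.

Lemma unplace_lerp c x y s : unplace c (lerp x y s) = lerp (unplace c x) (unplace c y) s.
Proof. unfold unplace, dot, displacement, lerp; cbn; f_equal; ring. Qed.

Lemma place_inj c x y : place c x = place c y -> x = y.
Proof. intros E; now rewrite <- (unplace_place c x), E, unplace_place. Qed.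

(** * Corners and sides of tiles in sector coordinates *)

Definition col (c : tile) : nat :=
  match c with
  | sq60 i _ | sq270 i _ | lo0 i _ | up0 i _ | lo150 i _ | up150 i _ => i
  end.

Definition row (c : tile) : nat :=
  match c with
  | sq60 _ j | sq270 _ j | lo0 _ j | up0 _ j | lo150 _ j | up150 _ j => j
  end.

Definition covers (c : tile) (y : R2) : Prop :=
  INR (col c) <= fst y <= INR (col c) + 1 /\
  INR (row c) <= snd y <= INR (row c) + 1 /\
  match c with
  | sq60 _ _ | sq270 _ _ => True
  | lo0 i j => fst y + snd y <= INR i + INR j + 1
  | up0 i j => INR i + INR j + 1 <= fst y + snd y
  | lo150 i j => INR i - INR j <= fst y - snd y
  | up150 i j => fst y - snd y <= INR i - INR j
  end.

Lemma covers_local c x : polygon (tile_kind c) x -> covers c (local c x).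
Proof.
pose proof sqrt3_sq as H; pose proof sqrt3_bounds as B.
destruct x as [x y]; intros P.
destruct c; unfold covers, local; cbn in *; try (repeat split; lra);
 destruct P as (P1 & P2 & P3);
 assert (0 <= sqrt 3 * y) by nra;
 assert (sqrt 3 * y <= 3 * x) by nra;
 assert (sqrt 3 * y <= 3 * (1 - x)) by nra;
 repeat split; lra.
Qed.

Lemma local_onto c y : covers c y -> exists x, polygon (tile_kind c) x /\ local c x = y.
Proof.
pose proof sqrt3_sq as H; pose proof sqrt3_bounds as B.
destruct y as [s t].
assert (T : forall u v, 0 <= u -> 0 <= v -> u + v <= 1 ->
  exists x, polygon Triangle x /\ bary Triangle x = (u, v)).
{ intros u v Hu Hv Huv; exists (u + v / 2, sqrt 3 / 2 * v); unfold bary; cbn.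
  repeat split; try nra; f_equal; field [H]. }
destruct c; unfold covers, local; cbn; intros (P1 & P2 & P3);
 [ exists (s - INR i, t - INR j); cbn; repeat split; try lra; f_equal; ring
 | exists (s - INR i, t - INR j); cbn; repeat split; try lra; f_equal; ring
 | destruct (T (s - INR i) (t - INR j)) as (x & Px & Ex)
 | destruct (T (INR i + 1 - s) (INR j + 1 - t)) as (x & Px & Ex)
 | destruct (T (s - INR i - (t - INR j)) (t - INR j)) as (x & Px & Ex)
 | destruct (T (s - INR i) (t - INR j - (s - INR i))) as (x & Px & Ex) ];
 try lra; exists x; split; try exact Px;
 pose proof (f_equal fst Ex) as F1; pose proof (f_equal snd Ex) as F2;
 cbn in F1, F2; f_equal; lra.
Qed.

Lemma covers_quadrant c y : covers c y -> quadrant y.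
Proof.
intros (P1 & P2 & _); pose proof (pos_INR (col c)); pose proof (pos_INR (row c)).
split; lra.
Qed.

Definition has_side (c : tile) (p q : R2) : Prop :=
  exists a b, side (tile_kind c) a b /\ local c a = p /\ local c b = q.

Lemma has_side_sym c p q : has_side c p q -> has_side c q p.
Proof. intros (a & b & [H|H] & Ha & Hb); exists b, a; unfold side; tauto. Qed.

Lemma local_corners c :
  map (local c) (model_corners (tile_kind c)) =
  let (i, j) := (INR (col c), INR (row c)) in
  match c with
  | sq60 _ _ | sq270 _ _ => [(i, j); (i + 1, j); (i + 1, j + 1); (i, j + 1)]
  | lo0 _ _ => [(i, j); (i + 1, j); (i, j + 1)]
  | up0 _ _ => [(i + 1, j + 1); (i, j + 1); (i + 1, j)]
  | lo150 _ _ => [(i, j); (i + 1, j); (i + 1, j + 1)]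
  | up150 _ _ => [(i, j); (i + 1, j + 1); (i, j + 1)]
  end.
Proof.
pose proof sqrt3_sq as H.
destruct c; unfold local; cbn; repeat (f_equal; try (field [H])).
Qed.

Lemma has_side_cyclic c p q :
  In (p, q) (cyclic_pairs (map (local c) (model_corners (tile_kind c)))) ->
  has_side c p q.
Proof.
intros H.
assert (E : exists a b, In (a, b) (cyclic_pairs (model_corners (tile_kind c))) /\
   local c a = p /\ local c b = q).
{ destruct (tile_kind c); cbn in *;
  decompose [or] H; try contradiction;
  match goal with E : (local c ?a, local c ?b) = _ |- _ =>
   exists a, b; injection E; intros; subst; tauto end. }
destruct E as (a & b & Hin & Ha & Hb); exists a, b; unfold side; tauto.
Qed.

Lemma side_cyclic c a b :
  side (tile_kind c) a b ->
  let l := cyclic_pairs (map (local c) (model_corners (tile_kind c))) in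
  In (local c a, local c b) l \/ In (local c b, local c a) l.
Proof.
unfold side; destruct (tile_kind c); cbn; intros [H|H]; [left|right|left|right];
  decompose [or] H; try contradiction;
  match goal with E : (_, _) = _ |- _ => injection E; intros; subst; tauto end.
Qed.

Lemma nat_between (i n : nat) (s : R) :
  INR i <= s <= INR i + 1 -> INR n < s < INR n + 1 -> i = n.
Proof.
intros A B; rewrite <- !S_INR in *.
assert (i < S n)%nat by (apply INR_lt; lra).
assert (n < S i)%nat by (apply INR_lt; lra). lia.
Qed.

Lemma nat_endpoint (i n : nat) :
  INR i <= INR n <= INR i + 1 -> INR n = INR i \/ INR n = INR i + 1.
Proof.
intros [A B]; rewrite <- S_INR in *.
apply INR_le in A; apply INR_le in B.
assert (n = i \/ n = S i) as [->| ->] by lia; auto.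
Qed.

Lemma nat_floor (s : R) : 0 <= s -> exists n, INR n <= s < INR n + 1.
Proof.
intros Hs.
destruct (archimed s) as [A B].
exists (Z.to_nat (up s - 1)).
assert (0 < up s)%Z by (apply lt_IZR; lra).
rewrite INR_IZR_INZ, Z2Nat.id by lia.
rewrite minus_IZR; lra.
Qed.

(** This and the next two lemmas determine the carrier of a point of a tile from
    the integrality of its coordinates alone, so that two tiles sharing a point
    get the same carrier. *)
Lemma lattice_corner c (n m : nat) :
  covers c (INR n, INR m) ->
  exists a, In a (model_corners (tile_kind c)) /\ local c a = (INR n, INR m).
Proof.
intros (P1 & P2 & P3); cbn in P1, P2.
assert (I : In (INR n, INR m) (map (local c) (model_corners (tile_kind c)))).
{ rewrite local_corners.
  destruct (nat_endpoint _ _ P1) as [E1|E1], (nat_endpoint _ _ P2) as [E2|E2];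
    rewrite E1, E2 in *; destruct c; cbn in *; try tauto; exfalso; lra. }
apply in_map_iff in I as (a & Ea & Ia); now exists a.
Qed.

Lemma row_side c (n m : nat) (s : R) :
  covers c (s, INR m) -> INR n < s < INR n + 1 ->
  has_side c (INR n, INR m) (INR n + 1, INR m).
Proof.
intros (P1 & P2 & P3) Hs; cbn in P1, P2.
pose proof (nat_between _ _ _ P1 Hs); subst n.
assert (G : In ((INR (col c), INR m), (INR (col c) + 1, INR m))
              (cyclic_pairs (map (local c) (model_corners (tile_kind c)))) \/
            In ((INR (col c) + 1, INR m), (INR (col c), INR m))
              (cyclic_pairs (map (local c) (model_corners (tile_kind c))))).
{ rewrite local_corners.
  destruct (nat_endpoint _ _ P2) as [E2|E2];
    rewrite E2 in *; destruct c; cbn in *; try tauto; exfalso; lra. }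
destruct G as [G|G]; [|apply has_side_sym]; now apply has_side_cyclic.
Qed.

Lemma col_side c (n m : nat) (t : R) :
  covers c (INR n, t) -> INR m < t < INR m + 1 ->
  has_side c (INR n, INR m) (INR n, INR m + 1).
Proof.
intros (P1 & P2 & P3) Ht; cbn in P1, P2.
pose proof (nat_between _ _ _ P2 Ht); subst m.
assert (G : In ((INR n, INR (row c)), (INR n, INR (row c) + 1))
              (cyclic_pairs (map (local c) (model_corners (tile_kind c)))) \/
            In ((INR n, INR (row c) + 1), (INR n, INR (row c)))
              (cyclic_pairs (map (local c) (model_corners (tile_kind c))))).
{ rewrite local_corners.
  destruct (nat_endpoint _ _ P1) as [E1|E1];
    rewrite E1 in *; destruct c; cbn in *; try tauto; exfalso; lra. }
destruct G as [G|G]; [|apply has_side_sym]; now apply has_side_cyclic.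
Qed.

Lemma tile_at k y : quadrant y -> exists c, sector c = k /\ covers c y.
Proof.
intros [Hs Ht].
destruct (nat_floor _ Hs) as (n & Hn), (nat_floor _ Ht) as (m & Hm).
unfold covers; destruct k.
- destruct (Rle_dec (fst y + snd y) (INR n + INR m + 1));
    [exists (lo0 n m)|exists (up0 n m)]; cbn; repeat split; lra.
- exists (sq60 n m); cbn; repeat split; lra.
- destruct (Rle_dec (INR n - INR m) (fst y - snd y));
    [exists (lo150 n m)|exists (up150 n m)]; cbn; repeat split; lra.
- exists (sq270 n m); cbn; repeat split; lra.
Qed.

(** * Gluing the tiles *)

(** The cut of the parallelogram with lower corner [(n, m)]; the value is
    relevant only in the sectors tiled by triangles. *)
Definition diagonal (k : ray) (n m : nat) : R2 * R2 :=
  match k with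
  | E0 => ((INR n + 1, INR m), (INR n, INR m + 1))
  | _ => ((INR n, INR m), (INR n + 1, INR m + 1))
  end.

Definition on_diagonal (k : ray) (n m : nat) (y : R2) : Prop :=
  match k with
  | E0 => fst y + snd y = INR n + INR m + 1
  | E150 => fst y - snd y = INR n - INR m
  | _ => False
  end.

Lemma diagonal_side c (n m : nat) y :
  covers c y -> INR n < fst y < INR n + 1 -> INR m < snd y < INR m + 1 ->
  on_diagonal (sector c) n m y ->
  has_side c (fst (diagonal (sector c) n m)) (snd (diagonal (sector c) n m)).
Proof.
intros (P1 & P2 & P3) Hs Ht D.
pose proof (nat_between _ _ _ P1 Hs); pose proof (nat_between _ _ _ P2 Ht); subst n m.
assert (G : let p := fst (diagonal (sector c) (col c) (row c)) in
            let q := snd (diagonal (sector c) (col c) (row c)) in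
            In (p, q) (cyclic_pairs (map (local c) (model_corners (tile_kind c)))) \/
            In (q, p) (cyclic_pairs (map (local c) (model_corners (tile_kind c))))).
{ rewrite local_corners; destruct c; cbn in *; tauto. }
destruct G as [G|G]; [|apply has_side_sym]; now apply has_side_cyclic.
Qed.

Lemma interior_tile c c' (n m : nat) y :
  sector c = sector c' -> covers c y -> covers c' y ->
  INR n < fst y < INR n + 1 -> INR m < snd y < INR m + 1 ->
  ~ on_diagonal (sector c) n m y -> c = c'.
Proof.
intros E (P1 & P2 & P3) (Q1 & Q2 & Q3) Hs Ht D.
pose proof (nat_between _ _ _ P1 Hs); pose proof (nat_between _ _ _ P2 Ht).
pose proof (nat_between _ _ _ Q1 Hs); pose proof (nat_between _ _ _ Q2 Ht).
destruct c, c'; cbn in *; try discriminate; subst; try reflexivity;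
  exfalso; apply D; lra.
Qed.

Definition common_face (c c' : tile) (z : R2) : Prop :=
  (exists a a', In a (model_corners (tile_kind c)) /\
     In a' (model_corners (tile_kind c')) /\ place c a = z /\ place c' a' = z) \/
  (exists a b a' b', side (tile_kind c) a b /\ side (tile_kind c') a' b' /\
     place c a = place c' a' /\ place c b = place c' b' /\
     exists s, 0 <= s <= 1 /\ z = lerp (place c a) (place c b) s).

Lemma common_side c c' p q p' q' s :
  has_side c p q -> has_side c' p' q' ->
  pt (sector c) p = pt (sector c') p' -> pt (sector c) q = pt (sector c') q' ->
  0 <= s <= 1 -> common_face c c' (pt (sector c) (lerp p q s)).
Proof.
intros (a & b & H & Ha & Hb) (a' & b' & H' & Ha' & Hb') Ep Eq Hs.
right; exists a, b, a', b'; unfold place; rewrite Ha, Hb, Ha', Hb'.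
repeat split; trivial. exists s; split; trivial. apply pt_lerp.
Qed.

Lemma common_corner c c' (n m n' m' : nat) :
  covers c (INR n, INR m) -> covers c' (INR n', INR m') ->
  pt (sector c) (INR n, INR m) = pt (sector c') (INR n', INR m') ->
  common_face c c' (pt (sector c) (INR n, INR m)).
Proof.
intros H H' E.
destruct (lattice_corner _ _ _ H) as (a & Ia & Ea).
destruct (lattice_corner _ _ _ H') as (a' & Ia' & Ea').
left; exists a, a'; unfold place; rewrite Ea, Ea'; auto.
Qed.

(** If a coordinate of the common point is an integer, or if the point is on a
    cut, then every tile of the sector through the point has the same corner or
    side there.  Otherwise the integer parts of the coordinates and the side of
    the cut determine the tile. *)
Lemma glue_same_sector c c' y :
  sector c = sector c' -> covers c y -> covers c' y ->
  c = c' \/ common_face c c' (pt (sector c) y).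
Proof.
intros E H H'.
destruct (covers_quadrant _ _ H) as [Hs Ht].
destruct (nat_floor _ Hs) as (n & Hn), (nat_floor _ Ht) as (m & Hm).
destruct y as [s t]; cbn [fst snd] in *.
destruct (Req_dec s (INR n)) as [->|Ns].
- right; destruct (Req_dec t (INR m)) as [->|Nt].
  + apply common_corner with n m; congruence.
  + replace (INR n, t) with (lerp (INR n, INR m) (INR n, INR m + 1) (t - INR m))
      by (unfold lerp; cbn; f_equal; ring).
    apply common_side with (INR n, INR m) (INR n, INR m + 1); try congruence; try lra;
      apply col_side with t; trivial; lra.
- destruct (Req_dec t (INR m)) as [->|Nt].
  + right.
    replace (s, INR m) with (lerp (INR n, INR m) (INR n + 1, INR m) (s - INR n))
      by (unfold lerp; cbn; f_equal; ring).
    apply common_side with (INR n, INR m) (INR n + 1, INR m); try congruence; try lra;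
      apply row_side with s; trivial; lra.
  + destruct (classic (on_diagonal (sector c) n m (s, t))) as [D|D].
    * right.
      replace (s, t) with (lerp (fst (diagonal (sector c) n m))
         (snd (diagonal (sector c) n m)) (t - INR m)).
      2: { destruct (sector c); cbn in D; try contradiction;
           unfold lerp; cbn; f_equal; lra. }
      apply common_side with (fst (diagonal (sector c) n m))
         (snd (diagonal (sector c) n m)); try congruence; try lra.
      -- apply diagonal_side with (s, t); cbn; trivial; lra.
      -- rewrite E in *; apply diagonal_side with (s, t); cbn; trivial; lra.
    * left; apply interior_tile with n m (s, t); cbn; trivial; lra.
Qed.

Lemma glue_next_sector c c' r :
  sector c' = next (sector c) -> covers c (0, r) -> covers c' (r, 0) ->
  common_face c c' (pt (sector c) (0, r)).
Proof.
intros E H H'.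
destruct (covers_quadrant _ _ H) as [_ Hr]; cbn in Hr.
assert (P : forall t, pt (sector c) (0, t) = pt (sector c') (t, 0)).
{ intros t; rewrite E; unfold pt; cbn; f_equal; ring. }
destruct (nat_floor _ Hr) as (n & Hn).
change 0 with (INR 0) in *.
destruct (Req_dec r (INR n)) as [->|N].
- apply common_corner with n 0%nat; trivial; apply P.
- replace (INR 0, r) with (lerp (INR 0, INR n) (INR 0, INR n + 1) (r - INR n))
    by (unfold lerp; cbn; f_equal; ring).
  apply common_side with (INR n, INR 0) (INR n + 1, INR 0); try apply P; try lra.
  + apply col_side with r; trivial; lra.
  + apply row_side with r; trivial; lra.
Qed.

Lemma common_face_sym c c' z : common_face c c' z -> common_face c' c z.
Proof.
intros [(a & a' & H)|(a & b & a' & b' & H1 & H2 & Ea & Eb & s & H)].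
- left; exists a', a; tauto.
- right; exists a', b', a, b; rewrite <- Ea, <- Eb; repeat split; trivial.
  exists s; exact H.
Qed.

(** Tiles of different sectors meet on the common ray of the two sectors, or only
    at the origin if the sectors are opposite. *)
Lemma tiles_overlap c c' y y' :
  covers c y -> covers c' y' -> pt (sector c) y = pt (sector c') y' ->
  c = c' \/ common_face c c' (pt (sector c) y).
Proof.
intros H H' E.
pose proof (covers_quadrant _ _ H) as Q; pose proof (covers_quadrant _ _ H') as Q'.
destruct (ray_dec (sector c) (sector c')) as [S|S].
{ rewrite <- S in E; apply pt_inj in E; trivial; subst y'.
  now apply glue_same_sector. }
right.
pose proof (fun r => coord_unique _ _ _ _ r Q Q' E) as U; clear Q Q'.
destruct y as [y1 y2], y' as [y1' y2'].
destruct (ray_dec (sector c') (next (sector c))) as [S1|S1].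
{ assert (y1 = 0 /\ y1' = y2 /\ y2' = 0) as (-> & -> & ->).
  { pose proof (U (sector c)) as U1; pose proof (U (next (sector c))) as U2;
    pose proof (U (next (sector c'))) as U3.
    rewrite S1 in *; destruct (sector c); cbn in *; auto. }
  now apply glue_next_sector. }
destruct (ray_dec (sector c) (next (sector c'))) as [S2|S2].
{ rewrite E; apply common_face_sym.
  assert (y1' = 0 /\ y1 = y2' /\ y2 = 0) as (-> & -> & ->).
  { pose proof (U (sector c')) as U1; pose proof (U (next (sector c'))) as U2;
    pose proof (U (next (sector c))) as U3.
    rewrite S2 in *; destruct (sector c'); cbn in *; auto. }
  now apply glue_next_sector. }
assert (y1 = INR 0 /\ y2 = INR 0 /\ y1' = INR 0 /\ y2' = INR 0) as (-> & -> & -> & ->).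
{ pose proof (U E0) as U0; pose proof (U E60) as U1; pose proof (U E150) as U2;
  pose proof (U E270) as U3.
  destruct (sector c), (sector c'); cbn in *; repeat split; congruence. }
now apply common_corner with 0%nat 0%nat.
Qed.

Lemma side_length k a b : side k a b -> eucl a b = 1.
Proof.
pose proof sqrt3_sq as H.
intros S; rewrite <- sqrt_1; unfold eucl, dist_euc; f_equal; unfold Rsqr.
destruct k; unfold side in S; cbn in S; destruct S as [S|S]; decompose [or] S;
  try contradiction; match goal with E : (_, _) = _ |- _ => injection E; intros; subst end;
  cbn; field [H].
Qed.

Lemma eucl_lerp a b s t : eucl (lerp a b s) (lerp a b t) = Rabs (s - t) * eucl a b.
Proof.
unfold eucl, dist_euc. rewrite <- sqrt_Rsqr_abs, <- sqrt_mult_alt by apply Rle_0_sqr.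
f_equal; unfold lerp, Rsqr; cbn; ring.
Qed.

Lemma place_surj p : exists c x, polygon (tile_kind c) x /\ place c x = p.
Proof.
destruct (sectors_cover p) as (k & y & Q & -> & _).
destruct (tile_at k y Q) as (c & <- & C).
destruct (local_onto _ _ C) as (x & P & <-); exists c, x; auto.
Qed.

Lemma place_glue c c' x x' :
  polygon (tile_kind c) x -> polygon (tile_kind c') x' -> place c x = place c' x' ->
  (c = c' /\ x = x') \/
  exists A A' h,
    proper_face (tile_kind c) A /\ proper_face (tile_kind c') A' /\
    face_isometry h A A' /\ A x /\ h x = x' /\
    (forall y, A y -> place c y = place c' (h y)).
Proof.
intros P P' E.
destruct (tiles_overlap _ _ _ _ (covers_local _ _ P) (covers_local _ _ P') E)
  as [->|[(a & a' & Ia & Ia' & Ea & Ea')|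
          (a & b & a' & b' & S & S' & Ea & Eb & s & Hs & Es)]].
- left; split; trivial. now apply place_inj in E.
- fold (place c x) in Ea, Ea'.
  apply place_inj in Ea as ->.
  rewrite E in Ea'; apply place_inj in Ea' as ->.
  right; exists (eq x), (eq x'), (fun _ => x').
  repeat split; try (now constructor); try (now intros; subst).
  + intros y <-; now exists x.
  + intros u v <- <-; unfold eucl; now rewrite !distance_refl.
- right; fold (place c x) in Es.
  pose proof (side_length _ _ _ S) as L; pose proof (side_length _ _ _ S') as L'.
  assert (X : x = lerp a b s) by (apply (place_inj c); now rewrite Es, place_lerp).
  assert (X' : x' = lerp a' b' s)
    by (apply (place_inj c'); now rewrite <- E, Es, place_lerp, Ea, Eb).
  (* A common side is unit long, so the scalar product is the parameter of [y]. *)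
  pose (h := fun y => lerp a' b' (dot (displacement a y) (displacement a b))).
  assert (Hh : forall t, h (lerp a b t) = lerp a' b' t).
  { intros t; unfold h; f_equal.
    assert (Q : dot (displacement a b) (displacement a b) = 1).
    { unfold eucl, dist_euc in L. rewrite <- sqrt_1 in L.
      apply sqrt_inj in L; [| |lra].
      - unfold dot, displacement; cbn; rewrite <- L; unfold Rsqr; ring.
      - apply Rplus_le_le_0_compat; apply Rle_0_sqr. }
    transitivity (t * dot (displacement a b) (displacement a b)); [|rewrite Q; ring].
    unfold dot, displacement, lerp; cbn; ring. }
  exists (segment a b), (segment a' b'), h.
  repeat split; try (now constructor).
  + intros y (t & Ht & ->); exists t; now rewrite Hh.
  + intros y (t & Ht & ->); exists (lerp a b t); split; [now exists t|apply Hh].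
  + intros y y' (t & _ & ->) (t' & _ & ->); now rewrite !Hh, !eucl_lerp, L, L'.
  + now exists s.
  + now rewrite X, Hh.
  + intros y (t & _ & ->); now rewrite Hh, !place_lerp, Ea, Eb.
Qed.

Definition plane : ts_complex :=
  {| point := R2; cell := tile; shape := tile_kind; char := place;
     char_surj := place_surj; char_glue := place_glue |}.

(** * The complex is a radial flat *)

Lemma chain_app (P : Type) (piece : P -> P -> R -> Prop) p q r a b :
  chain piece p q a -> chain piece q r b -> chain piece p r (a + b).
Proof.
intros H; revert r b; induction H as [|p q' q a' a Hp Hc IH]; intros r b Hb.
- now rewrite Rplus_0_l.
- rewrite Rplus_assoc; apply chain_cons with q'; auto.
Qed.

Lemma chain_one (P : Type) (piece : P -> P -> R -> Prop) p q a :
  piece p q a -> chain piece p q a.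
Proof.
intros H; rewrite <- (Rplus_0_r a); apply chain_cons with q; [trivial|constructor].
Qed.

(** A function subject to the triangle inequality bounds all chains from below
    as soon as it bounds the single jumps. *)
Lemma chain_bound (P : Type) (piece : P -> P -> R -> Prop) (m : P -> P -> R) :
  (forall p, m p p = 0) -> (forall p q r, m p r <= m p q + m q r) ->
  (forall p q a, piece p q a -> m p q <= a) ->
  forall p q a, chain piece p q a -> m p q <= a.
Proof.
intros M0 MT MP p q a H; induction H as [|p q r a b Hp Hc IH]; [now rewrite M0; lra|].
specialize (MP _ _ _ Hp); specialize (MT p q r); lra.
Qed.

Lemma eucl_triangle p q r : eucl p r <= eucl p q + eucl q r.
Proof. unfold eucl; apply triangle. Qed.

Lemma half_lines_trace (L : list (R * R)) (lo hi : R) :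
  exists lo' hi', forall t,
    (lo <= t <= hi /\ Forall (fun f => 0 <= fst f + snd f * t) L) <-> lo' <= t <= hi'.
Proof.
revert lo hi; induction L as [|[a b] L IH]; intros lo hi.
{ exists lo, hi; intros t; split; [tauto|]; intros H; auto. }
assert (exists lo' hi', forall t, (lo <= t <= hi /\ 0 <= a + b * t) <-> lo' <= t <= hi')
  as (l1 & h1 & H1).
{ destruct (Rtotal_order b 0) as [N|[->|N]].
  - exists lo, (Rmin hi (a / - b)); intros t.
    assert (E : 0 <= a + b * t <-> t <= a / - b).
    { replace (a + b * t) with (- b * (a / - b - t)) by (field; lra).
      split; intros; nra. }
    rewrite E; unfold Rmin; destruct (Rle_dec hi (a / - b)); lra.
  - destruct (Rle_dec 0 a); [exists lo, hi|exists 1, 0]; intros t; lra.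
  - exists (Rmax lo (- a / b)), hi; intros t.
    assert (E : 0 <= a + b * t <-> - a / b <= t).
    { replace (a + b * t) with (b * (t - - a / b)) by (field; lra).
      split; intros; nra. }
    rewrite E; unfold Rmax; destruct (Rle_dec lo (- a / b)); lra. }
destruct (IH l1 h1) as (l2 & h2 & H2).
exists l2, h2; intros t; rewrite <- H2, <- H1, Forall_cons_iff; cbn; tauto.
Qed.

Definition in_tile (c : tile) (z : R2) : Prop := polygon (tile_kind c) (unplace c z).

Lemma tile_trace c p q :
  exists lo hi, forall t, (0 <= t <= 1 /\ in_tile c (lerp p q t)) <-> lo <= t <= hi.
Proof.
unfold in_tile.
assert (exists L, forall t, polygon (tile_kind c) (unplace c (lerp p q t)) <->
   Forall (fun f => 0 <= fst f + snd f * t) L) as (L & HL).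
{ setoid_rewrite unplace_lerp.
  destruct (unplace c p) as [x y], (unplace c q) as [x' y'].
  destruct (tile_kind c).
  - exists [(y, y' - y); (sqrt 3 * x - y, sqrt 3 * (x' - x) - (y' - y));
            (sqrt 3 * (1 - x) - y, - sqrt 3 * (x' - x) - (y' - y))].
    intros t; rewrite !Forall_cons_iff; cbn; split; intros H.
    + decompose [and] H; refine (conj _ (conj _ (conj _ (Forall_nil _)))); lra.
    + lra.
  - exists [(x, x' - x); (1 - x, x - x'); (y, y' - y); (1 - y, y - y')].
    intros t; rewrite !Forall_cons_iff; cbn; split; intros H.
    + decompose [and] H; refine (conj _ (conj _ (conj _ (conj _ (Forall_nil _))))); lra.
    + lra. }
destruct (half_lines_trace L 0 1) as (lo & hi & H).
exists lo, hi; intros t; now rewrite HL.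
Qed.

Lemma within_tile c p q :
  in_tile c p -> in_tile c q -> within_cell plane p q (eucl p q).
Proof.
intros Hp Hq; exists c, (unplace c p), (unplace c q).
repeat split; trivial; try (symmetry; apply place_unplace).
now rewrite <- (place_isometry c (unplace c p)), !place_unplace.
Qed.

(** A finite family of closed intervals covering an open interval cuts it into
    finitely many pieces, each inside one of the intervals: remove the interval
    of one tile and treat separately what remains on its left and on its right.
    Covering only the open interval as hypothesis avoids a limit argument
    at the ends of these two remainders. *)
Lemma chain_of_cover (L : list tile) p q : forall a b,
  0 <= a -> a <= b -> b <= 1 ->
  (forall t, a < t < b -> exists c, In c L /\ in_tile c (lerp p q t)) ->
  chain (within_cell plane) (lerp p q a) (lerp p q b) ((b - a) * eucl p q).
Proof.
induction L as [|c L IH]; intros a b Ha Hab Hb H.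
{ destruct (Req_dec a b) as [->|N].
  - replace ((b - b) * eucl p q) with 0 by ring; constructor.
  - destruct (H ((a + b) / 2)) as (c & [] & _); lra. }
destruct (tile_trace c p q) as (lo & hi & T).
destruct (Rle_dec (Rmax a lo) (Rmin b hi)) as [M|M].
- pose proof (Rmax_l a lo); pose proof (Rmax_r a lo).
  pose proof (Rmin_l b hi); pose proof (Rmin_r b hi).
  replace ((b - a) * eucl p q) with
    ((Rmax a lo - a) * eucl p q +
     ((Rmin b hi - Rmax a lo) * eucl p q + (b - Rmin b hi) * eucl p q)) by ring.
  apply chain_app with (lerp p q (Rmax a lo)); [|apply chain_app with (lerp p q (Rmin b hi))].
  + apply IH; try lra; intros t Ht.
    assert (t < lo) by (unfold Rmax in Ht; destruct (Rle_dec a lo); lra).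
    destruct (H t) as (c' & [<-|I] & C); [lra| |now exists c'].
    assert (lo <= t <= hi) by (apply T; split; [lra|trivial]); lra.
  + apply chain_one.
    rewrite <- (Rabs_pos_eq (Rmin b hi - Rmax a lo)), <- Rabs_Ropp, Ropp_minus_distr,
      <- eucl_lerp by lra.
    apply within_tile with c; apply T; lra.
  + apply IH; try lra; intros t Ht.
    assert (hi < t) by (unfold Rmin in Ht; destruct (Rle_dec b hi); lra).
    destruct (H t) as (c' & [<-|I] & C); [lra| |now exists c'].
    assert (lo <= t <= hi) by (apply T; split; [lra|trivial]); lra.
- apply IH; trivial; intros t Ht.
  destruct (H t Ht) as (c' & [<-|I] & C); [|now exists c'].
  exfalso; apply M.
  assert (lo <= t <= hi) by (apply T; split; [lra|trivial]).
  apply Rle_trans with t; [apply Rmax_lub|apply Rmin_glb]; lra.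
Qed.

Definition tiles_below (n : nat) : list tile :=
  flat_map (fun i => flat_map (fun j =>
    [sq60 i j; sq270 i j; lo0 i j; up0 i j; lo150 i j; up150 i j]) (seq 0 n)) (seq 0 n).

Lemma in_tiles_below c n : (col c < n)%nat -> (row c < n)%nat -> In c (tiles_below n).
Proof.
intros Hi Hj; apply in_flat_map; exists (col c); split; [apply in_seq; lia|].
apply in_flat_map; exists (row c); split; [apply in_seq; lia|].
destruct c; cbn; tauto.
Qed.

Lemma tile_over z : exists c, in_tile c z /\
  INR (col c) <= 2 * (Rabs (fst z) + Rabs (snd z)) /\
  INR (row c) <= 2 * (Rabs (fst z) + Rabs (snd z)).
Proof.
destruct (sectors_cover z) as (k & y & Q & Ez & Bs & Bt).
destruct (tile_at k y Q) as (c & Sc & C).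
destruct (local_onto _ _ C) as (x & P & Ex).
exists c; split.
- unfold in_tile; rewrite Ez, <- Sc, <- Ex; fold (place c x); now rewrite unplace_place.
- destruct C as (C1 & C2 & _); split; lra.
Qed.

(** The quotient metric is therefore the Euclidean one: a segment is bounded, so
    finitely many tiles cover it. *)
Lemma straight_chain p q : chain (within_cell plane) p q (eucl p q).
Proof.
pose (M := 2 * (Rabs (fst p) + Rabs (fst q) + (Rabs (snd p) + Rabs (snd q)))).
assert (0 <= M) as HM.
{ unfold M; pose proof (Rabs_pos (fst p)); pose proof (Rabs_pos (fst q));
  pose proof (Rabs_pos (snd p)); pose proof (Rabs_pos (snd q)); lra. }
destruct (nat_floor M HM) as (n & Hn).
replace (eucl p q) with ((1 - 0) * eucl p q) by ring.
rewrite <- (lerp_0 p q) at 1; rewrite <- (lerp_1 p q) at 2.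
apply chain_of_cover with (tiles_below (S n)); try lra.
intros t Ht; destruct (tile_over (lerp p q t)) as (c & T & Bi & Bj).
assert (B : forall x y, Rabs ((1 - t) * x + t * y) <= Rabs x + Rabs y).
{ intros x y; eapply Rle_trans; [apply Rabs_triang|].
  rewrite !Rabs_mult, (Rabs_pos_eq (1 - t)), (Rabs_pos_eq t) by lra.
  pose proof (Rabs_pos x); pose proof (Rabs_pos y); nra. }
pose proof (B (fst p) (fst q)) as B1; pose proof (B (snd p) (snd q)) as B2.
unfold M in Hn; cbn in Bi, Bj.
exists c; split; trivial.
apply in_tiles_below; apply INR_lt; rewrite S_INR; lra.
Qed.

Lemma glb_attained (E : R -> Prop) (m : R) :
  E m -> (forall x, E x -> m <= x) -> Glb_Rbar E = Finite m.
Proof.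
intros Hm H; apply is_glb_Rbar_unique; split.
- intros x Hx; now apply H.
- intros b Hb; now apply Hb.
Qed.

Lemma dist2_plane (p q : R2) : dist2 plane p q = Finite (eucl p q).
Proof.
apply glb_attained; [apply straight_chain|].
apply (chain_bound _ (within_cell plane) eucl).
- intros; apply distance_refl.
- apply eucl_triangle.
- intros p' q' a (c & x & y & _ & _ & -> & -> & ->).
  cbn; rewrite place_isometry; lra.
Qed.

Lemma plane_flat : flat plane.
Proof.
exists (fun p => p); repeat split.
- trivial.
- intros x; now exists x.
- intros; apply dist2_plane.
Qed.

Definition origin : R2 := (0, 0).

Lemma corners_place c :
  corners plane c = map (pt (sector c)) (map (local c) (model_corners (tile_kind c))).
Proof. unfold corners; now rewrite map_map. Qed.

Lemma origin_corner c :
  In origin (corners plane c) <->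
  In c [lo0 0 0; lo150 0 0; up150 0 0; sq60 0 0; sq270 0 0].
Proof.
split.
- rewrite corners_place; intros H; apply in_map_iff in H as (y & Ey & Iy).
  assert (Q : quadrant y).
  { rewrite local_corners in Iy.
    pose proof (pos_INR (col c)); pose proof (pos_INR (row c)).
    destruct c; cbn in *; decompose [or] Iy; try contradiction; subst y;
      split; cbn; lra. }
  assert (y = (0, 0)) as ->.
  { apply (pt_inj (sector c)); trivial; [split; cbn; lra|].
    rewrite Ey; unfold pt, origin; cbn; f_equal; ring. }
  rewrite local_corners in Iy.
  pose proof (pos_INR (col c)); pose proof (pos_INR (row c)).
  assert (Z : forall n, 0 = INR n -> n = 0%nat)
    by (intros n En; symmetry; apply INR_eq; exact En).
  destruct c; cbn in *; decompose [or] Iy; try contradiction;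
    match goal with E : (_, _) = _ |- _ => injection E; intros E1 E2 end;
    try (exfalso; lra); symmetry in E1, E2; apply Z in E1, E2; subst; tauto.
- rewrite corners_place, local_corners.
  assert (O : forall k, pt k (0, 0) = origin)
    by (intros; unfold pt, origin; cbn; f_equal; ring).
  intros H; cbn in H; decompose [or] H; try contradiction; subst c; left; apply O.
Qed.

Lemma plane_corner : corner_vertex plane origin.
Proof.
exists [lo0 0 0; lo150 0 0; up150 0 0], [sq60 0 0; sq270 0 0].
split; [|split; [|split; [|split; [|split; [|split]]]]]; try reflexivity.
1, 2: repeat constructor; cbn; intuition discriminate.
1, 2: intros c; split;
  [ intros H; split; [|apply origin_corner]; cbn in *;
    decompose [or] H; try contradiction; subst c; try reflexivity; tauto
  | intros [H1 H2]; apply origin_corner in H2; cbn in *;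
    decompose [or] H2; try contradiction; subst c; try discriminate; tauto ].
(* The two squares are in opposite sectors, which meet only at the origin. *)
assert (N : forall a b a' b', side Square a b -> place (sq60 0 0) a = origin ->
  place (sq60 0 0) b = place (sq270 0 0) b' -> side Square a' b' -> False).
{ intros a b a' b' S Ea Eb S'.
  assert (In b (model_corners Square) /\ In b' (model_corners Square)) as [Ib Ib'].
  { unfold side in S, S'; cbn in S, S' |- *; split.
    - destruct S as [S|S]; decompose [or] S; try contradiction;
      match goal with E : (_, _) = _ |- _ => injection E; intros; subst end; tauto.
    - destruct S' as [S'|S']; decompose [or] S'; try contradiction;
      match goal with E : (_, _) = _ |- _ => injection E; intros; subst end; tauto. }
  assert (Pb : forall x, In x (model_corners Square) -> polygon Square x).
  { intros x Hx; cbn in Hx; decompose [or] Hx; try contradiction; subst; cbn; lra. }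
  assert (Q : quadrant (local (sq60 0 0) b))
    by (apply covers_quadrant with (sq60 0 0), covers_local, Pb, Ib).
  assert (Q' : quadrant (local (sq270 0 0) b'))
    by (apply covers_quadrant with (sq270 0 0), covers_local, Pb, Ib').
  pose proof (coord_unique _ _ _ _ E60 Q Q' Eb) as U1.
  pose proof (coord_unique _ _ _ _ E150 Q Q' Eb) as U2.
  assert (b = (0, 0)).
  { destruct b as [b1 b2], b'; unfold local in U1, U2; cbn in *; f_equal; lra. }
  assert (a = (0, 0)).
  { apply (place_inj (sq60 0 0)); rewrite Ea; unfold place, local, pt, origin; cbn;
    f_equal; ring. }
  pose proof (side_length _ _ _ S) as L; subst; unfold eucl in L.
  rewrite distance_refl in L; lra. }
intros c c' Hc Hc' Ne (a & b & a' & b' & S & S' & Ea & Eab).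
pose proof (Eab 1 ltac:(lra)) as Eb; pose proof (Eab 0 ltac:(lra)) as Ea'.
rewrite !lerp_1 in Eb; rewrite !lerp_0 in Ea'.
cbn in Hc, Hc', S, S', Ea, Eb, Ea'.
destruct Hc as [<-|[<-|[]]], Hc' as [<-|[<-|[]]]; try congruence.
- now apply (N a b a' b').
- apply (N a' b' a b); trivial; [exact (eq_trans (eq_sym Ea') Ea)|now symmetry].
Qed.

(** The first row of squares of the sector at [E60] is in the region. *)
Lemma plane_quadrant_unbounded : unbounded plane (region plane (sq60 0 0)).
Proof.
assert (R : forall i, same_region plane (sq60 0 0) (sq60 i 0)).
{ induction i as [|i IH]; [apply rst_refl|].
  apply rst_trans with (sq60 i 0); trivial; apply rst_step; split; [reflexivity|].
  exists (place (sq60 i 0) (1, 0)), (1, 0), (1, 1), (0, 0), (0, 1).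
  split; [left; cbn; tauto|]; split; [right; cbn; tauto|]; split; [reflexivity|].
  intros s _; cbn -[INR]; unfold place, local, lerp; cbn -[INR].
  rewrite S_INR; f_equal; f_equal; ring. }
intros M.
assert (0 <= Rmax 0 M) as H0 by apply Rmax_l.
destruct (nat_floor _ H0) as (n & Hn).
exists (place (sq60 0 0) (0, 0)), (place (sq60 (S n) 0) (0, 0)).
split; [|split].
- exists (sq60 0 0), (0, 0); repeat split; try apply R; cbn; lra.
- exists (sq60 (S n) 0), (0, 0); repeat split; try apply R; cbn; lra.
- rewrite dist2_plane.
  replace (place (sq60 (S n) 0) (0, 0)) with (place (sq60 0 0) (INR (S n), 0))
    by (unfold place, local; cbn -[INR]; f_equal; f_equal; cbn; ring).
  rewrite place_isometry.
  apply Rlt_le_trans with (INR (S n)).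
  + rewrite S_INR; pose proof (Rmax_r 0 M); lra.
  + unfold eucl, dist_euc; cbn [fst snd].
    rewrite <- (sqrt_Rsqr (INR (S n))) at 1 by apply pos_INR.
    apply sqrt_le_1_alt; unfold Rsqr; nra.
Qed.

Lemma plane_radial : radial plane.
Proof.
split; [exists origin; apply plane_corner|].
exists (sq60 0 0); apply plane_quadrant_unbounded.
Qed.

(** * Potentials *)

Definition sector_coords (z : R2) : {kx : ray * R2 | quadrant (snd kx) /\ z = pt (fst kx) (snd kx)}.
Proof.
apply constructive_indefinite_description.
destruct (sectors_cover z) as (k & x & Q & E & _); now exists (k, x).
Qed.

(** The function that is linear on each sector and has slope [al k] along the
    ray [k]. *)
Definition pot (al : ray -> R) (z : R2) : R :=
  let '(k, x) := proj1_sig (sector_coords z) in al k * fst x + al (next k) * snd x.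

Lemma pot_pt al k x : quadrant x -> pot al (pt k x) = al k * fst x + al (next k) * snd x.
Proof.
intros Q; unfold pot.
destruct (sector_coords (pt k x)) as [[l y] [Q' E]]; cbn [proj1_sig fst snd] in *.
assert (S : forall k x, al k * fst x + al (next k) * snd x =
  al E0 * coord k x E0 + al E60 * coord k x E60 +
  al E150 * coord k x E150 + al E270 * coord k x E270)
  by (intros [] []; cbn; ring).
rewrite !S; now rewrite !(fun r => coord_unique k l x y r Q Q' E).
Qed.

(** Exactly the slopes for which [pot al] varies by at most 1 along an edge: besides
    the directions of the rays, the edges have the directions [(-1, 1)] in the
    sector of angle 60 and [(1, 1)] in the sector of angle 120. *)
Definition slow (al : ray -> R) : Prop :=
  (forall k, Rabs (al k) <= 1) /\ Rabs (al E60 - al E0) <= 1 /\ Rabs (al E150 + al E270) <= 1.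

Definition translate (x v : R2) : R2 := (fst x + fst v, snd x + snd v).

Definition direction (k : ray) (v : R2) : Prop :=
  v = (1, 0) \/ v = (-1, 0) \/ v = (0, 1) \/ v = (0, -1) \/
  match k with
  | E0 => v = (1, -1) \/ v = (-1, 1)
  | E150 => v = (1, 1) \/ v = (-1, -1)
  | _ => False
  end.

Lemma corners_polygon k a : In a (model_corners k) -> polygon k a.
Proof.
pose proof sqrt3_sq; pose proof sqrt3_bounds.
intros I; destruct k; cbn in *; decompose [or] I; try contradiction; subst a; cbn;
 repeat split; nra.
Qed.

Lemma side_corners k a b : side k a b -> In a (model_corners k) /\ In b (model_corners k).
Proof.
unfold side; destruct k; cbn; intros [S|S]; decompose [or] S; try contradiction;
  match goal with E : (_, _) = _ |- _ => injection E; intros; subst end; tauto.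
Qed.

Lemma corner_quadrant c a : In a (model_corners (tile_kind c)) -> quadrant (local c a).
Proof. intros I; apply covers_quadrant with c, covers_local, corners_polygon, I. Qed.

Lemma side_direction c a b :
  side (tile_kind c) a b ->
  exists v, direction (sector c) v /\ local c b = translate (local c a) v.
Proof.
intros S; exists (displacement (local c a) (local c b)).
split; [|destruct (local c b); unfold translate, displacement; cbn; f_equal; ring].
apply side_cyclic in S; cbn zeta in S; rewrite local_corners in S.
revert S; generalize (local c a) (local c b); intros p q S.
destruct c; cbn in S; destruct S as [S|S]; decompose [or] S; try contradiction;
 match goal with E : (_, _) = _ |- _ => injection E; intros <- <- end;
 unfold direction, displacement; cbn;
 match goal with |- context [(?a, ?b) = (1, 0)] =>
   ring_simplify a; ring_simplify b end; tauto.
Qed.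

Lemma adjacent_inv p q :
  adjacent plane p q ->
  exists k x v, quadrant x /\ quadrant (translate x v) /\ direction k v /\
    p = pt k x /\ q = pt k (translate x v).
Proof.
intros (c & a & b & S & -> & ->).
destruct (side_direction c a b S) as (v & D & Ev).
destruct (side_corners _ _ _ S) as [Ia Ib].
exists (sector c), (local c a), v; rewrite <- Ev.
repeat split; trivial; now apply corner_quadrant.
Qed.

Lemma has_side_adjacent c p q :
  has_side c p q -> adjacent plane (pt (sector c) p) (pt (sector c) q).
Proof. intros (a & b & S & <- & <-); now exists c, a, b. Qed.

Lemma adjacent_sym (F : ts_complex) u v : adjacent F u v -> adjacent F v u.
Proof. intros (c & a & b & S & -> & ->); exists c, b, a; unfold side in *; tauto. Qed.

Lemma slow_direction al k v : slow al -> direction k v ->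
  Rabs (al k * fst v + al (next k) * snd v) <= 1.
Proof.
intros (S1 & S2 & S3) D.
pose proof (S1 E0); pose proof (S1 E60); pose proof (S1 E150); pose proof (S1 E270).
repeat match goal with H : Rabs _ <= _ |- _ => apply Rabs_le_between in H end.
apply Rabs_le_between.
destruct D as [->|[->|[->|[->|D]]]]; cbn; destruct k; cbn; try lra; try contradiction;
 destruct D as [->| ->]; cbn; lra.
Qed.

(** The potential is affine on an edge, which lies in one sector, so the bound on
    unit edges passes to their parts. *)
Lemma pot_edge al p q a : slow al -> within_edge plane p q a -> pot al p - pot al q <= a.
Proof.
intros Sl (c & e1 & e2 & x & y & S & (s & Hs & ->) & (t & Ht & ->) & -> & -> & ->).
destruct (side_direction c e1 e2 S) as (v & D & Ev).
destruct (side_corners _ _ _ S) as [I1 I2].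
pose proof (corner_quadrant _ _ I1) as [Q1 Q1']; pose proof (corner_quadrant _ _ I2) as [Q2 Q2'].
rewrite eucl_lerp, (side_length _ _ _ S).
change (char (t:=plane)) with place; unfold place.
rewrite !local_lerp, !pot_pt by (split; unfold lerp; cbn; nra).
rewrite Ev; unfold lerp, translate; cbn [fst snd].
apply (slow_direction al) in D; trivial.
rewrite Rmult_1_r.
match goal with |- ?l <= _ => replace l with
  ((s - t) * (al (sector c) * fst v + al (next (sector c)) * snd v)) by ring end.
eapply Rle_trans; [apply Rle_abs|]; rewrite Rabs_mult.
rewrite <- (Rmult_1_r (Rabs (s - t))) at 2; apply Rmult_le_compat_l; trivial; apply Rabs_pos.
Qed.

(** Slow potentials provide all the lower bounds on distances in the
    1-skeleton. *)
Lemma pot_le_d al p q : slow al -> Rbar_le (Finite (pot al p - pot al q)) (d plane p q).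
Proof.
intros Sl; unfold d; destruct (Glb_Rbar_correct (chain (within_edge plane) p q)) as [_ G].
apply G; intros x Hx; cbn; clear G.
revert p q x Hx.
apply (chain_bound _ (within_edge plane) (fun p q => pot al p - pot al q)); intros; try lra.
now apply pot_edge.
Qed.

Lemma pot_adjacent al p q : slow al -> adjacent plane p q -> pot al p - pot al q <= 1.
Proof.
intros Sl A; destruct (adjacent_inv p q A) as (k & x & v & Q & Q' & D & -> & ->).
rewrite !pot_pt by trivial; apply (slow_direction al) in D; trivial.
apply Rabs_le_between in D; unfold translate; cbn; lra.
Qed.

Lemma edge_path_head (F : ts_complex) u l v : edge_path F u l v -> exists l', l = u :: l'.
Proof. intros []; eauto. Qed.

Lemma path_length_cons (F : ts_complex) x u l v :
  edge_path F u l v -> path_length F (x :: l) = S (path_length F l).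
Proof. intros H; destruct (edge_path_head _ _ _ _ H) as [l' ->]; reflexivity. Qed.

Lemma pot_path al u l v :
  slow al -> edge_path plane u l v -> pot al u - pot al v <= INR (path_length plane l).
Proof.
intros Sl P; induction P as [u _|u w v l A P IH]; [cbn; lra|].
rewrite (path_length_cons _ _ _ _ _ P), S_INR.
pose proof (pot_adjacent al u w Sl A); lra.
Qed.

Lemma adjacent_within (F : ts_complex) u v : adjacent F u v -> within_edge F u v 1.
Proof.
intros (c & a & b & S & -> & ->); exists c, a, b, a, b.
repeat split; trivial.
- exists 0; split; [lra|now rewrite lerp_0].
- exists 1; split; [lra|now rewrite lerp_1].
- symmetry; now apply side_length with (shape c).
Qed.

Lemma path_chain (F : ts_complex) u l v :
  edge_path F u l v -> chain (within_edge F) u v (INR (path_length F l)).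
Proof.
intros P; induction P as [u _|u w v l A P IH]; [constructor|].
rewrite (path_length_cons _ _ _ _ _ P), S_INR, Rplus_comm.
apply chain_cons with w; trivial; now apply adjacent_within.
Qed.

Lemma chain_le_d (F : ts_complex) p q a : chain (within_edge F) p q a -> Rbar_le (d F p q) a.
Proof.
intros C; destruct (Glb_Rbar_correct (chain (within_edge F) p q)) as [L _].
exact (L a C).
Qed.

(** Such a path is a geodesic when [al] is slow: the potential certifies that no
    path is shorter. *)
Definition steep (al : ray -> R) u l v : Prop :=
  edge_path plane u l v /\ pot al u - pot al v = INR (path_length plane l).

Lemma steep_geodesic al u l v : slow al -> steep al u l v -> geodesic plane u l v.
Proof.
intros Sl [P E]; split; trivial; intros l' P'.
apply INR_le; rewrite <- E; now apply pot_path.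
Qed.

Lemma steep_d al u l v : slow al -> steep al u l v ->
  d plane u v = Finite (pot al u - pot al v).
Proof.
intros Sl [P E]; apply Rbar_le_antisym; [|now apply pot_le_d].
rewrite E; now apply chain_le_d, path_chain.
Qed.

Lemma edge_path_vertex (F : ts_complex) u l v : edge_path F u l v -> vertex F u.
Proof.
intros [u' V|u' w v' l' A P]; trivial.
destruct A as (c & a & b & S & -> & _); exists c; apply in_map.
now apply side_corners in S.
Qed.

Lemma steep_interval al u v w l l' : slow al -> steep al u l w -> steep al w l' v ->
  (exists l'', steep al u l'' v) -> in_interval plane u v w.
Proof.
intros Sl S1 S2 [l'' S3]; split; [apply (edge_path_vertex _ _ _ _ (proj1 S2))|].
rewrite (steep_d al u l w), (steep_d al w l' v), (steep_d al u l'' v) by trivial.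
cbn; f_equal; ring.
Qed.

Lemma steep_cons al u w l v :
  adjacent plane u w -> pot al u = pot al w + 1 -> steep al w l v -> steep al u (u :: l) v.
Proof.
intros A E [P L]; split; [now apply path_cons with w|].
rewrite (path_length_cons _ _ _ _ _ P), S_INR; lra.
Qed.

(** A neighbour [w] of [u] for which some slow potential contradicts this bound
    does not start a geodesic. *)
Lemma first_edge_bound u v w l :
  edge_path plane u l v -> first_edge plane u v w ->
  adjacent plane u w /\
  forall al, slow al -> pot al w - pot al v <= INR (path_length plane l) - 1.
Proof.
intros P (l' & P' & G).
inversion P' as [|? w' ? l'' A Pw]; subst.
destruct (edge_path_head _ _ _ _ Pw) as [l0 E0']; injection E0'; intros; subst.
split; trivial; intros al Sl.
apply G in P; rewrite (path_length_cons _ _ _ _ _ Pw) in P.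
apply le_INR in P; rewrite S_INR in P.
pose proof (pot_path al _ _ _ Sl Pw); lra.
Qed.

Lemma first_edge_intro al u v w l :
  slow al -> adjacent plane u w -> pot al u = pot al w + 1 -> steep al w l v ->
  first_edge plane u v w.
Proof.
intros Sl A E S.
destruct (edge_path_head _ _ _ _ (proj1 S)) as [l' ->].
exists l'; apply steep_geodesic with al; trivial.
now apply steep_cons with w.
Qed.

(** Prolongs a Gersten-Short geodesic backwards by an edge that slow potentials
    single out among all the edges at [u]. *)
Lemma forced_step al u u' v l :
  slow al -> adjacent plane u u' -> pot al u = pot al u' + 1 ->
  steep al u' l v -> gersten_short plane u' l v ->
  (forall w, adjacent plane u w ->
     (forall be, slow be -> pot be w - pot be v <= INR (path_length plane l)) -> w = u') ->
  steep al u (u :: l) v /\ gersten_short plane u (u :: l) v.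
Proof.
intros Sl A E S G U.
assert (S' : steep al u (u :: l) v) by now apply steep_cons with u'.
split; trivial; apply gs_edge with u'; trivial.
- intros ->; destruct S as [_ S]; pose proof (pos_INR (path_length plane l)); lra.
- intros w; split; [|intros ->; now apply first_edge_intro with al l].
  intros H; apply (first_edge_bound u v w (u :: l)) in H as [Aw B]; [|apply S'].
  apply U; trivial; intros be Hb; specialize (B be Hb).
  rewrite (path_length_cons _ _ _ _ _ (proj1 S)), S_INR in B; lra.
Qed.

(** In the sectors not containing the point [pt k0 x0], the four equations on
    coordinates are contradictory; so this lists the edges at the point by sector
    and direction. *)
Lemma neighbours k0 x0 w :
  quadrant x0 -> adjacent plane (pt k0 x0) w ->
  exists k x v, quadrant x /\ quadrant (translate x v) /\ direction k v /\
    (forall r, coord k0 x0 r = coord k x r) /\ w = pt k (translate x v) /\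
    forall al, pot al w = al k * (fst x + fst v) + al (next k) * (snd x + snd v).
Proof.
intros Q0 A; destruct (adjacent_inv _ _ A) as (k & x & v & Q & Q' & D & E & ->).
exists k, x, v; split; trivial; split; trivial; split; trivial; split.
- intros r; now apply coord_unique.
- split; trivial; intros al; now rewrite pot_pt.
Qed.

(** * The geodesic turning around the corner *)

Definition slopes (a b c e : R) (k : ray) : R :=
  match k with E0 => a | E60 => b | E150 => c | E270 => e end.

(** Both potentials fall at full speed along the two geodesics to be built.  Each
    falls along other edges too: [drop'] along those pointing left before the
    vertex [(1, 0)], [drop] along those of direction 60 degrees from there on.
    Together they leave no choice on the geodesic around the corner. *)
Definition drop : ray -> R := slopes 0 (-1) (-1) 1.
Definition drop' : ray -> R := slopes 1 0 (-1) 1.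

Ltac solve_slow :=
  split; [intros []|split]; cbn; apply Rabs_le_between; lra.

Lemma slow_drop : slow drop. Proof. solve_slow. Qed.
Lemma slow_drop' : slow drop'. Proof. solve_slow. Qed.

(** In the square sector at [E60], [n] edges parallel to the ray [E150]. *)
Fixpoint run (x n : nat) : list R2 :=
  pt E60 (1, INR x) :: match n with O => [] | S n' => run (S x) n' end.

(** In the square sector at [E270], [j] edges up to the vertex [(1, 0)]; then
    one edge across the first triangle to the first vertex of the ray [E60], and a
    run of length [n]. *)
Fixpoint climb (j n : nat) : list R2 :=
  match j with
  | O => pt E270 (0, 1) :: run 0 n
  | S j' => pt E270 (INR j, 1) :: climb j' n
  end.

Lemma pt_vertex k (n m : nat) : vertex plane (pt k (INR n, INR m)).
Proof.
destruct (tile_at k (INR n, INR m)) as (c & <- & H); [split; apply pos_INR|].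
destruct (lattice_corner _ _ _ H) as (a & Ia & Ea).
exists c; unfold corners; apply in_map_iff; exists a; split; trivial.
change (place c a = pt (sector c) (INR n, INR m)); unfold place; now rewrite Ea.
Qed.

Lemma adjacent_col k (n m : nat) :
  adjacent plane (pt k (INR n, INR m)) (pt k (INR n, INR m + 1)).
Proof.
assert (exists c, sector c = k /\ covers c (INR n, INR m + 1 / 2)) as (c & <- & H).
{ destruct k;
    [exists (lo0 n m)|exists (sq60 n m)|exists (up150 n m)|exists (sq270 n m)];
    unfold covers; cbn; repeat split; lra. }
apply has_side_adjacent, col_side with (INR m + 1 / 2); trivial; lra.
Qed.

Lemma adjacent_row k (n m : nat) :
  adjacent plane (pt k (INR n, INR m)) (pt k (INR n + 1, INR m)).
Proof.
assert (exists c, sector c = k /\ covers c (INR n + 1 / 2, INR m)) as (c & <- & H).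
{ destruct k;
    [exists (lo0 n m)|exists (sq60 n m)|exists (lo150 n m)|exists (sq270 n m)];
    unfold covers; cbn; repeat split; lra. }
apply has_side_adjacent, row_side with (INR n + 1 / 2); trivial; lra.
Qed.

Lemma adjacent_antidiagonal (n m : nat) :
  adjacent plane (pt E0 (INR n + 1, INR m)) (pt E0 (INR n, INR m + 1)).
Proof.
assert (H : covers (lo0 n m) (INR n + 1 / 2, INR m + 1 / 2))
  by (unfold covers; cbn; repeat split; lra).
apply (has_side_adjacent (lo0 n m)).
apply (diagonal_side _ n m _ H); cbn; lra.
Qed.

Ltac quad := split; cbn [fst snd];
  repeat match goal with |- context [INR ?n] =>
    lazymatch goal with H : 0 <= INR n |- _ => fail | _ => pose proof (pos_INR n) end end;
  rewrite ?S_INR in *; lra.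

Ltac use_neighbours Q A k x y v Q1 Q2 D E P U :=
  destruct (neighbours _ _ _ Q A) as (k & [x y] & v & _ & [Q1 Q2] & D & U & E & P);
  pose proof (U E0); pose proof (U E60); pose proof (U E150); pose proof (U E270);
  clear U.

Lemma run_steep al (n x : nat) :
  al E150 = -1 ->
  steep al (pt E60 (1, INR x)) (run x n) (pt E60 (1, INR (x + n))).
Proof.
intros E; revert x; induction n as [|n IH]; intros x; cbn [run].
- rewrite Nat.add_0_r; change 1 with (INR 1).
  split; [constructor; apply pt_vertex|cbn; lra].
- replace (x + S n)%nat with (S x + n)%nat by lia.
  apply steep_cons with (pt E60 (1, INR (S x))); trivial.
  + rewrite S_INR; apply (adjacent_col E60 1 x).
  + rewrite !pot_pt by quad; rewrite S_INR; cbn -[INR]; rewrite E; lra.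
Qed.

Lemma run_gs (n x : nat) :
  gersten_short plane (pt E60 (1, INR x)) (run x n) (pt E60 (1, INR (x + n))).
Proof.
revert x; induction n as [|n IH]; intros x; cbn [run].
- rewrite Nat.add_0_r; change 1 with (INR 1); constructor; apply pt_vertex.
- pose proof (run_steep drop' n (S x) eq_refl) as St.
  replace (x + S n)%nat with (S x + n)%nat by lia.
  pose proof (proj2 St) as Len.
  assert (Q : quadrant (1, INR x)) by quad.
  apply (forced_step drop' _ (pt E60 (1, INR (S x)))); trivial.
  + apply slow_drop'.
  + rewrite S_INR; apply (adjacent_col E60 1 x).
  + rewrite !pot_pt by quad; rewrite S_INR; cbn -[INR]; lra.
  + intros w A B; specialize (B drop' slow_drop'); rewrite <- Len in B.
    use_neighbours Q A k y z v Q1 Q2 D E P U.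
    rewrite P, !pot_pt in B by quad; rewrite S_INR in *.
    unfold direction in D; destruct k; cbn -[INR] in *; try (exfalso; lra);
    decompose [or] D; try contradiction; subst v; cbn -[INR] in *; try (exfalso; lra).
    rewrite E; unfold translate; cbn -[INR]; do 2 f_equal; lra.
Qed.

(** At every vertex the first edge is forced.  Below [(1, 0)], the potential
    [drop] falls along the upward edge only.  At [(1, 0)] it also falls along the
    edge of direction 60 degrees, where [drop'] is constant.  After that the only
    edge along which [drop'] falls is the one of direction 150 degrees. *)
Lemma climb_gs (j n : nat) :
  steep drop (pt E270 (INR j, 1)) (climb j n) (pt E60 (1, INR n)) /\
  gersten_short plane (pt E270 (INR j, 1)) (climb j n) (pt E60 (1, INR n)).
Proof.
induction j as [|j [St IH]]; cbn [climb].
- pose proof (run_steep drop n 0 eq_refl) as St; pose proof (run_gs n 0) as G.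
  pose proof (proj2 St) as Len; pose proof (proj2 (run_steep drop' n 0 eq_refl)) as Len'.
  cbn [Nat.add] in *.
  assert (Q : quadrant (INR 0, 1)) by quad.
  assert (C : pt E270 (INR 0, 1) = pt E0 (INR 0 + 1, INR 0))
    by (unfold pt; cbn; f_equal; ring).
  apply (forced_step drop _ (pt E60 (1, INR 0))); trivial.
  + apply slow_drop.
  + rewrite C.
    replace (pt E60 (1, INR 0)) with (pt E0 (INR 0, INR 0 + 1))
      by (unfold pt; cbn; f_equal; ring).
    apply adjacent_antidiagonal.
  + rewrite !pot_pt by quad; cbn; lra.
  + intros w A B; pose proof (B drop slow_drop) as B1; pose proof (B drop' slow_drop') as B2.
    clear B; rewrite <- Len in B1; rewrite <- Len' in B2; clear St Len Len' G C.
    use_neighbours Q A k y z v Q1 Q2 D E P U.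
    rewrite P, !pot_pt in B1, B2 by quad; clear P.
    unfold direction in D; destruct k; cbn -[INR] in *; change (INR 0) with 0 in *; try (exfalso; lra);
    decompose [or] D; try contradiction; subst v; cbn -[INR] in *; try (exfalso; lra).
    assert (y = 1) as -> by lra; assert (z = 0) as -> by lra.
    rewrite E; unfold translate, pt; cbn; f_equal; field.
- pose proof (proj2 St) as Len.
  assert (Q : quadrant (INR (S j), 1)) by quad.
  apply (forced_step drop _ (pt E270 (INR j, 1))); trivial.
  + apply slow_drop.
  + apply adjacent_sym; rewrite S_INR; apply (adjacent_row E270 j 1).
  + rewrite !pot_pt by quad; rewrite S_INR; cbn -[INR]; lra.
  + intros w A B; specialize (B drop slow_drop).
    rewrite <- Len in B; clear St Len IH.
    use_neighbours Q A k y z v Q1 Q2 D E P U.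
    rewrite P, !pot_pt in B by quad; clear P.
    pose proof (pos_INR j); rewrite S_INR in *.
    unfold direction in D; destruct k; cbn -[INR] in *; try (exfalso; lra);
    decompose [or] D; try contradiction; subst v; cbn -[INR] in *; try (exfalso; lra).
    rewrite E; unfold translate; cbn -[INR]; do 2 f_equal; lra.
Qed.

(** * The geodesic across the sector of angle 120 *)

(** The [x]-th lattice point of the line parallel to the ray [E150] through
    the [n]-th vertex of the ray [E270]. *)
Definition wide_pt (x n : nat) : R2 := pt E150 (INR x, INR n).

(** Zigzag with edges of directions 90 and 150 degrees in turn: [n] rhombi,
    each made of two triangles, are passed on one side. *)
Fixpoint zigzag (x n : nat) : list R2 :=
  pt E150 (INR x, INR n) ::
  match n with
  | O => []
  | S n' => pt E150 (INR x, INR n') :: zigzag (S x) n'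
  end.

Lemma spans_corners (F : ts_complex) k l :
  spans F k l -> exists c, shape c = k /\ forall p, In p l <-> In p (corners F c).
Proof.
intros (c & K & [(l1 & l2 & E & ->)|(l1 & l2 & E & ->)]); exists c; split; trivial; intros p;
 [|rewrite (in_rev (corners F c))]; rewrite E, !in_app_iff; tauto.
Qed.

Lemma corner_coords c p :
  In p (corners plane c) ->
  exists y, In y (map (local c) (model_corners (tile_kind c))) /\ quadrant y /\
    p = pt (sector c) y.
Proof.
rewrite corners_place; intros I; apply in_map_iff in I as (y & <- & Iy).
exists y; repeat split; trivial;
  apply in_map_iff in Iy as (a & <- & Ia); now apply corner_quadrant.
Qed.

Lemma interior_sector c k x :
  0 < fst x -> 0 < snd x -> In (pt k x) (corners plane c) -> sector c = k.
Proof.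
intros H1 H2 I; destruct (corner_coords _ _ I) as (y & _ & Qy & E).
assert (Qx : quadrant x) by (split; lra).
pose proof (fun r => coord_unique _ _ _ _ r Qx Qy E) as U.
pose proof (U E0); pose proof (U E60); pose proof (U E150); pose proof (U E270).
destruct k, (sector c); cbn in *; trivial; exfalso; lra.
Qed.

Lemma no_square_inside l p x :
  0 < fst x -> 0 < snd x -> p = pt E150 x -> In p l -> ~ spans plane Square l.
Proof.
intros H1 H2 -> I S; destruct (spans_corners _ _ _ S) as (c & K & H).
apply H, interior_sector in I; trivial.
destruct c; discriminate.
Qed.

(** A tile with a corner in the interior of the sector belongs to the sector; the
    edge in question is the cut of a parallelogram, so it is on its two halves
    only. *)
Lemma third_vertex x n e :
  spans plane Triangle [wide_pt x n; e; wide_pt (S x) (S n)] -> e = wide_pt (S x) n \/ e = wide_pt x (S n).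
Proof.
intros Sp; destruct (spans_corners _ _ _ Sp) as (c & K & H).
assert (I1 : In (wide_pt x n) (corners plane c)) by (apply H; cbn; tauto).
assert (I2 : In (wide_pt (S x) (S n)) (corners plane c)) by (apply H; cbn; tauto).
assert (Sc : sector c = E150).
{ apply interior_sector in I2; trivial; cbn [fst snd]; apply lt_0_INR; lia. }
assert (L : forall y, quadrant y -> In (pt E150 y) (corners plane c) ->
   In y (map (local c) (model_corners (tile_kind c)))).
{ intros y Q I; destruct (corner_coords _ _ I) as (y' & Iy & Q' & E).
  rewrite Sc in E; apply pt_inj in E; trivial; now subst. }
assert (T : forall y, In y (map (local c) (model_corners (tile_kind c))) ->
  y <> (INR x, INR n) -> y <> (INR (S x), INR (S n)) -> e = pt E150 y).
{ intros y Iy N1 N2.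
  assert (Q : quadrant y)
   by (apply in_map_iff in Iy as (a & <- & Ia); now apply corner_quadrant).
  assert (I : In (pt E150 y) [wide_pt x n; e; wide_pt (S x) (S n)]).
  { apply H; rewrite corners_place, Sc; now apply in_map. }
  destruct I as [I|[I|[I|[]]]]; trivial; apply pt_inj in I; trivial; try congruence;
  split; cbn [fst snd]; apply pos_INR. }
apply L in I1; [|quad]; apply L in I2; [|quad]; clear L H K Sp.
rewrite local_corners in *; unfold wide_pt.
destruct c as [i j|i j|i j|i j|i j|i j]; try discriminate Sc; clear Sc; cbn -[INR pt] in *; rewrite S_INR in *;
 rewrite (S_INR n) in *; destruct I1 as [I1|[I1|[I1|[]]]]; injection I1 as J1 J2;
 destruct I2 as [I2|[I2|[I2|[]]]]; injection I2 as J3 J4; try (exfalso; lra).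
- left; replace (INR n) with (INR j) by lra; replace (INR x) with (INR i) by lra.
  apply T; [auto| |]; intros Y; injection Y; lra.
- right; replace (INR n) with (INR j) by lra; replace (INR x) with (INR i) by lra.
  apply T; [auto| |]; intros Y; injection Y; lra.
Qed.

Lemma pot_drop_wide_pt x n : pot drop (wide_pt x n) = INR n - INR x.
Proof. unfold wide_pt; rewrite pot_pt by quad; cbn; ring. Qed.

Lemma wide_pt_adjacent_up x n : adjacent plane (wide_pt x (S n)) (wide_pt x n).
Proof. apply adjacent_sym; unfold wide_pt; rewrite S_INR; apply adjacent_col. Qed.

Lemma wide_pt_adjacent_left x n : adjacent plane (wide_pt x n) (wide_pt (S x) n).
Proof. unfold wide_pt; rewrite S_INR; apply adjacent_row. Qed.

Lemma steep_up x n l v :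
  steep drop (wide_pt x n) l v -> steep drop (wide_pt x (S n)) (wide_pt x (S n) :: l) v.
Proof.
apply steep_cons; [apply wide_pt_adjacent_up|rewrite !pot_drop_wide_pt, S_INR; ring].
Qed.

Lemma steep_left x n l v :
  steep drop (wide_pt (S x) n) l v -> steep drop (wide_pt x n) (wide_pt x n :: l) v.
Proof.
apply steep_cons; [apply wide_pt_adjacent_left|rewrite !pot_drop_wide_pt, S_INR; ring].
Qed.

Lemma steep_stay x n : steep drop (wide_pt x n) [wide_pt x n] (wide_pt x n).
Proof. split; [constructor; apply pt_vertex|cbn; lra]. Qed.

Lemma zigzag_head x n : zigzag x n = wide_pt x n :: tl (zigzag x n).
Proof. now destruct n. Qed.

Lemma zigzag_steep n x : steep drop (wide_pt x n) (zigzag x n) (wide_pt (x + n) 0).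
Proof.
revert x; induction n as [|n IH]; intros x.
- rewrite Nat.add_0_r; apply steep_stay.
- rewrite Nat.add_succ_r; exact (steep_up _ _ _ _ (steep_left _ _ _ _ (IH (S x)))).
Qed.

Lemma zigzag_steep_next n x :
  steep drop (wide_pt (S x) n) (zigzag (S x) n) (wide_pt (x + S n) 0).
Proof. rewrite Nat.add_succ_r; apply (zigzag_steep n (S x)). Qed.

Lemma zigzag_first_edges n x w :
  first_edge plane (wide_pt x (S n)) (wide_pt (x + S n) 0) w <-> w = wide_pt x n \/ w = wide_pt (S x) (S n).
Proof.
pose proof (zigzag_steep (S n) x) as St; pose proof (zigzag_steep_next n x) as St'.
split.
- intros H; apply (first_edge_bound _ _ _ _ (proj1 St)) in H as [A B].
  specialize (B drop slow_drop); rewrite <- (proj2 St) in B; clear St St'.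
  assert (Q : quadrant (INR x, INR (S n))) by quad.
  use_neighbours Q A k y z v Q1 Q2 D E P U.
  rewrite P, !pot_drop_wide_pt, plus_INR, !S_INR in B.
  pose proof (pos_INR n); pose proof (pos_INR x).
  unfold wide_pt; rewrite S_INR in *.
  unfold direction in D; destruct k; cbn -[INR] in *; change (INR 0) with 0 in B;
  try (exfalso; lra);
  decompose [or] D; try contradiction; subst v; cbn -[INR] in *; try (exfalso; lra);
  rewrite E; unfold translate; cbn -[INR pt].
  + right; rewrite S_INR; do 2 f_equal; lra.
  + left; do 2 f_equal; lra.
  + (* For [x = 0] the first point is also on the border of the sector [E270]. *)
    left; unfold pt; cbn -[INR]; f_equal; nra.
- intros [->| ->].
  + apply first_edge_intro with drop (wide_pt x n :: zigzag (S x) n);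
      [apply slow_drop|apply wide_pt_adjacent_up|rewrite !pot_drop_wide_pt, S_INR; ring|].
    now apply steep_left.
  + apply first_edge_intro with drop (wide_pt (S x) (S n) :: zigzag (S x) n);
      [apply slow_drop|apply wide_pt_adjacent_left|rewrite !pot_drop_wide_pt, !S_INR; ring|].
    now apply steep_up.
Qed.

Lemma spans_upper x n : spans plane Triangle [wide_pt x (S n); wide_pt x n; wide_pt (S x) (S n)].
Proof.
exists (up150 x n); split; trivial; left.
rewrite corners_place, local_corners; cbn -[INR pt].
exists [wide_pt x n; wide_pt (S x) (S n)], [wide_pt x (S n)]; unfold wide_pt; now rewrite !S_INR.
Qed.

Lemma spans_lower x n : spans plane Triangle [wide_pt x n; wide_pt (S x) n; wide_pt (S x) (S n)].
Proof.
exists (lo150 x n); split; trivial; left.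
rewrite corners_place, local_corners; cbn -[INR pt].
exists [], [wide_pt x n; wide_pt (S x) n; wide_pt (S x) (S n)]; unfold wide_pt; now rewrite !S_INR.
Qed.

Lemma rhombus_move x n :
  move_through plane (wide_pt x (S n)) (wide_pt (x + S n) 0) (wide_pt x n) (wide_pt (S x) (S n)) (wide_pt (S x) n)
    [wide_pt x (S n); wide_pt x n; wide_pt (S x) n] [wide_pt x (S n); wide_pt (S x) (S n); wide_pt (S x) n].
Proof.
pose proof (zigzag_steep_next n x) as Z.
assert (I : forall w l l', steep drop (wide_pt x (S n)) l w -> steep drop w l' (wide_pt (x + S n) 0) ->
  in_interval plane (wide_pt x (S n)) (wide_pt (x + S n) 0) w).
{ intros w l l' H H'; apply (steep_interval drop _ _ _ l l'); trivial.
  - apply slow_drop.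
  - exists (zigzag x (S n)); apply zigzag_steep. }
pose proof (I _ _ _ (steep_stay _ _) (steep_up _ _ _ _ (steep_left _ _ _ _ Z))).
pose proof (I _ _ _ (steep_up _ _ _ _ (steep_stay _ _)) (steep_left _ _ _ _ Z)).
pose proof (I _ _ _ (steep_left _ _ _ _ (steep_stay _ _)) (steep_up _ _ _ _ Z)).
pose proof (I _ _ _ (steep_up _ _ _ _ (steep_left _ _ _ _ (steep_stay _ _))) Z).
split; [|split; eexists; reflexivity].
split; [|split].
- apply move_triangles; [apply spans_upper|apply spans_lower].
- cbn; repeat (apply Forall_cons; trivial).
- exists (tl (zigzag (S x) n)); cbn [app]; rewrite <- zigzag_head.
  split; apply steep_geodesic with drop; try apply slow_drop.
  + now apply steep_up, steep_left.
  + now apply steep_left, steep_up.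
Qed.

(** The edge joining the two possible second vertices has an end in the interior
    of the sector, so it is on no square, and the move consists of two triangles
    sharing that edge.  By [third_vertex] it ends either where [rhombus_move]
    does or at its own start, and a geodesic does not return to its start. *)
Lemma rhombus_move_unique x n e t1 t2 :
  move_through plane (wide_pt x (S n)) (wide_pt (x + S n) 0) (wide_pt x n) (wide_pt (S x) (S n)) e t1 t2 ->
  e = wide_pt (S x) n /\ t1 = [wide_pt x (S n); wide_pt x n; wide_pt (S x) n] /\
  t2 = [wide_pt x (S n); wide_pt (S x) (S n); wide_pt (S x) n].
Proof.
intros [(M & _ & l & G & _) [H1 H2]].
assert (N : forall s, In (wide_pt (S x) (S n)) s -> ~ spans plane Square s).
{ intros s; apply no_square_inside with (INR (S x), INR (S n)); trivial;
  cbn [fst snd]; apply lt_0_INR; lia. }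
inversion M as [a b e' b' Sq|a b e' b' Tu Te|a e' m p q Hm _ Sq _]; subst;
  destruct H1 as [l1 B1], H2 as [l2 B2].
- exfalso; injection B2; intros; subst; apply (N _) in Sq; cbn; tauto.
- injection B1; injection B2; intros; subst.
  apply third_vertex in Te as [->| ->]; [auto|exfalso].
  destruct G as [P G]; specialize (G _ (proj1 (zigzag_steep (S n) x))).
  inversion P as [|? ? ? ? _ P1]; subst; inversion P1 as [|? ? ? ? _ P2]; subst.
  destruct (edge_path_head _ _ _ _ P2) as [l' E]; injection E as <- _.
  pose proof (pot_path drop _ _ _ slow_drop P2) as L.
  apply le_INR in G; rewrite <- (proj2 (zigzag_steep (S n) x)) in G.
  unfold path_length in *; cbn [app length pred] in *; rewrite !S_INR in G; lra.
- exfalso; cbn in B2; injection B2 as Eq _.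
  apply (fun I => N _ I (Sq 0%nat ltac:(lia))); rewrite Eq; cbn; tauto.
Qed.

Lemma zigzag_gs n x : gersten_short plane (wide_pt x n) (zigzag x n) (wide_pt (x + n) 0).
Proof.
revert x; induction n as [|n IH]; intros x.
- rewrite Nat.add_0_r; constructor; apply pt_vertex.
- specialize (IH (S x)); rewrite <- Nat.add_succ_comm in *.
  replace (zigzag x (S n)) with ([wide_pt x (S n); wide_pt x n; wide_pt (S x) n] ++ tl (zigzag (S x) n))
    by (cbn [app zigzag]; now rewrite <- zigzag_head).
  rewrite Nat.add_succ_comm in *.
  apply gs_move with (w1 := wide_pt x n) (w2 := wide_pt (S x) (S n)) (u' := wide_pt (S x) n)
    (s1 := [wide_pt x (S n); wide_pt x n; wide_pt (S x) n])
    (s2 := [wide_pt x (S n); wide_pt (S x) (S n); wide_pt (S x) n]); trivial.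
  + intros E; apply (f_equal (pot drop)) in E; rewrite !pot_drop_wide_pt, plus_INR, S_INR in E.
    pose proof (pos_INR n); cbn in E; lra.
  + intros E; apply pt_inj in E; [|quad|quad]; apply (f_equal fst), INR_eq in E; lia.
  + apply zigzag_first_edges.
  + apply rhombus_move.
  + apply rhombus_move_unique.
  + now left.
Qed.

(** * Distances between paths *)

Lemma adjacent_on_edge (F : ts_complex) u w :
  adjacent F u w -> on_edge F u w 0 u /\ on_edge F u w 1 w.
Proof.
intros (c & a & b & S & -> & ->); split; exists c, a, b;
 rewrite ?lerp_0, ?lerp_1; auto.
Qed.

Lemma on_path_single (F : ts_complex) u p : on_path F [u] p -> p = u.
Proof.
intros (t & [[_ E]|[[_ E]|(i & s & x & y & _ & _ & _ & E & _)]]); cbn in E; try congruence.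
now destruct i.
Qed.

Lemma on_path_cons (F : ts_complex) u w l p :
  adjacent F u w ->
  on_path F (u :: w :: l) p <->
  (exists s, 0 <= s <= 1 /\ on_edge F u w s p) \/ on_path F (w :: l) p.
Proof.
intros A; destruct (adjacent_on_edge _ _ _ A) as [A0 A1]; split.
- intros (t & [[Ht E]|[[Ht E]|(i & s & x & y & Et & Hs & Ex & Ey & E)]]).
  + left; exists 0; cbn in E; injection E as <-; split; [lra|trivial].
  + right; exists (t - 1); right; left; cbn -[INR] in *.
    rewrite S_INR in Ht; split; [lra|trivial].
  + destruct i as [|i]; cbn -[INR] in Ex, Ey.
    * left; exists s; injection Ex as <-; injection Ey as <-; auto.
    * right; exists (t - 1); right; right; exists i, s, x, y.
      rewrite S_INR in Et; repeat split; trivial; lra.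
- intros [(s & Hs & E)|(t & [[Ht E]|[[Ht E]|(i & s & x & y & Et & Hs & Ex & Ey & E)]])].
  + exists s; right; right; exists 0%nat, s, u, w; cbn; repeat split; trivial; lra.
  + cbn in E; injection E as <-.
    exists 1; right; right; exists 0%nat, 1, u, w; cbn; repeat split; trivial; lra.
  + exists (t + 1); right; left; cbn -[INR] in *; rewrite S_INR; split; [lra|trivial].
  + exists (t + 1); right; right; exists (S i), s, x, y.
    rewrite S_INR; repeat split; trivial; lra.
Qed.

Lemma on_edge_within (F : ts_complex) u w s p :
  0 <= s <= 1 -> on_edge F u w s p -> within_edge F p u s /\ within_edge F p w (1 - s).
Proof.
intros Hs (c & a & b & S & -> & -> & ->).
pose proof (side_length _ _ _ S) as L.
split; [exists c, a, b, (lerp a b s), a|exists c, a, b, (lerp a b s), b];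
  repeat split; trivial; try (exists s; auto; fail).
- exists 0; rewrite lerp_0; split; [lra|trivial].
- rewrite <- (lerp_0 a b) at 2; rewrite eucl_lerp, L, Rabs_pos_eq; lra.
- exists 1; rewrite lerp_1; split; [lra|trivial].
- rewrite <- (lerp_1 a b) at 2; rewrite eucl_lerp, L, Rabs_minus_sym, Rabs_pos_eq; lra.
Qed.

Lemma chain_to_end (F : ts_complex) u l v p :
  edge_path F u l v -> on_path F l p ->
  exists a, a <= INR (path_length F l) /\ chain (within_edge F) p v a.
Proof.
intros P; revert p; induction P as [u V|u w v l A P IH]; intros p O.
- apply on_path_single in O as ->; exists 0; split; [cbn; lra|constructor].
- destruct (edge_path_head _ _ _ _ P) as [l' ->].
  rewrite (path_length_cons _ u w (w :: l') v P), S_INR.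
  apply on_path_cons in O as [(s & Hs & O)|O]; trivial.
  + destruct (on_edge_within _ _ _ _ _ Hs O) as [_ W].
    exists (1 - s + INR (path_length F (w :: l'))); split; [lra|].
    apply chain_cons with w; trivial; now apply path_chain.
  + destruct (IH p O) as (a & Ha & C); exists a; split; [lra|trivial].
Qed.

Lemma on_path_end (F : ts_complex) u l v : edge_path F u l v -> on_path F l v.
Proof.
induction 1 as [u V|u w v l A P IH].
- exists 0; left; split; [lra|reflexivity].
- destruct (edge_path_head _ _ _ _ P) as [l' ->]; apply on_path_cons; auto.
Qed.

Lemma chain_nonneg (F : ts_complex) p q a : chain (within_edge F) p q a -> 0 <= a.
Proof.
apply (chain_bound _ (within_edge F) (fun _ _ => 0)); try (intros; lra).
intros ? ? ? (c & e1 & e2 & x & y & _ & _ & _ & _ & _ & ->); apply sqrt_pos.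
Qed.

Lemma d_nonneg (F : ts_complex) p q : Rbar_le 0 (d F p q).
Proof.
destruct (Glb_Rbar_correct (chain (within_edge F) p q)) as [_ G].
apply G; intros x Hx; now apply chain_nonneg with F p q.
Qed.

Lemma chain_d_finite (F : ts_complex) p q a :
  chain (within_edge F) p q a -> exists r, d F p q = Finite r /\ 0 <= r <= a.
Proof.
intros C; pose proof (chain_le_d _ _ _ _ C) as L; pose proof (d_nonneg F p q) as L0.
destruct (d F p q) as [r| |]; cbn in *; try contradiction; now exists r.
Qed.

Lemma d_finite_chain (F : ts_complex) p q :
  d F p q <> p_infty -> exists a, chain (within_edge F) p q a.
Proof.
intros N; apply NNPP; intros H; apply N.
apply is_glb_Rbar_unique; split.
- intros x Hx; exfalso; apply H; now exists x.
- intros b _; now destruct b.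
Qed.

Lemma d_extend (F : ts_complex) p q q' a x :
  chain (within_edge F) p q x -> within_edge F q q' a ->
  real (d F p q') <= real (d F p q) + a.
Proof.
intros C W.
destruct (chain_d_finite _ _ _ _ C) as (r & E & _).
destruct (chain_d_finite _ _ _ _ (chain_app _ _ _ _ _ _ _ C (chain_one _ _ _ _ _ W)))
  as (r' & E' & _).
rewrite E, E'; cbn.
assert (Rbar_le (Finite (r' - a)) (d F p q)) as L.
{ destruct (Glb_Rbar_correct (chain (within_edge F) p q)) as [_ G].
  apply G; intros y Hy.
  pose proof (chain_le_d _ _ _ _ (chain_app _ _ _ _ _ _ _ Hy (chain_one _ _ _ _ _ W))) as H.
  rewrite E' in H; cbn in *; lra. }
rewrite E in L; cbn in L; lra.
Qed.

Lemma lipschitz_minimum (f : R -> R) :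
  (forall s t, 0 <= s <= 1 -> 0 <= t <= 1 -> f s <= f t + Rabs (s - t)) ->
  exists s0, 0 <= s0 <= 1 /\ forall s, 0 <= s <= 1 -> f s0 <= f s.
Proof.
intros L.
(* The extreme value theorem requires continuity from both sides at 0 and 1. *)
pose (clamp := fun s => Rmax 0 (Rmin 1 s)).
assert (C0 : forall s, 0 <= clamp s <= 1).
{ intros s; unfold clamp, Rmax, Rmin; repeat destruct Rle_dec; lra. }
assert (C1 : forall s, 0 <= s <= 1 -> clamp s = s).
{ intros s Hs; unfold clamp, Rmax, Rmin; repeat destruct Rle_dec; lra. }
assert (C2 : forall s t, Rabs (clamp s - clamp t) <= Rabs (s - t)).
{ intros s t; unfold clamp, Rmax, Rmin, Rabs; repeat destruct Rle_dec;
  repeat destruct Rcase_abs; lra. }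
destruct (continuity_ab_min (fun s => f (clamp s)) 0 1) as (m & Hm & Bm); [lra| |].
- intros c _ e He; exists e; split; trivial; intros x [_ Hx]; cbn in *.
  unfold Rdist in *.
  pose proof (L (clamp x) (clamp c) (C0 x) (C0 c)).
  pose proof (L (clamp c) (clamp x) (C0 c) (C0 x)).
  pose proof (C2 x c); rewrite (Rabs_minus_sym (clamp c)) in *.
  apply Rabs_def1; lra.
- exists m; split; trivial; intros s Hs; specialize (Hm s Hs).
  now rewrite !C1 in Hm by trivial.
Qed.

Lemma on_edge_plane (u w q : R2) s : on_edge plane u w s q -> q = lerp u w s.
Proof. intros (c & a & b & _ & -> & -> & ->); apply place_lerp. Qed.

(** The distance to [p] is infinite on the whole edge, or 1-Lipschitz on it; in both
    cases it has a minimum there. *)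
Lemma nearest_on_edge p u w :
  adjacent plane u w ->
  exists q s, 0 <= s <= 1 /\ on_edge plane u w s q /\
    forall s' q', 0 <= s' <= 1 -> on_edge plane u w s' q' ->
      Rbar_le (d plane p q) (d plane p q').
Proof.
intros (c & a & b & S & -> & ->); cbn [char plane].
pose (g := lerp (place c a) (place c b)).
assert (G : forall s, g s = place c (lerp a b s)) by (intros s; symmetry; apply place_lerp).
assert (W : forall s t, 0 <= s <= 1 -> 0 <= t <= 1 ->
  within_edge plane (g t) (g s) (Rabs (s - t))).
{ intros s t Hs Ht; exists c, a, b, (lerp a b t), (lerp a b s).
  split; trivial; split; [now exists t|]; split; [now exists s|].
  split; [apply G|]; split; [apply G|].
  rewrite eucl_lerp, (side_length _ _ _ S), Rabs_minus_sym; ring. }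
assert (O : forall s, on_edge plane (place c a) (place c b) s (g s))
  by (intros s; rewrite G; now exists c, a, b).
destruct (classic (exists s, 0 <= s <= 1 /\ d plane p (g s) <> p_infty)) as [(s & Hs & N)|N].
- destruct (d_finite_chain _ _ _ N) as (x & C).
  assert (C' : forall t, 0 <= t <= 1 -> exists y, chain (within_edge plane) p (g t) y).
  { intros t Ht; eexists; apply chain_app with (g s); [exact C|].
    apply chain_one, W; trivial. }
  destruct (lipschitz_minimum (fun t => real (d plane p (g t)))) as (s0 & H0 & M).
  + intros s' t' Hs' Ht'; destruct (C' t' Ht') as (y & Cy).
    apply d_extend with y; auto.
  + exists (g s0), s0; split; trivial; split; trivial.
    intros t q Ht Oq; apply on_edge_plane in Oq as ->; fold (g t).
    destruct (C' s0 H0) as (y & Cy), (C' t Ht) as (y' & Cy').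
    destruct (chain_d_finite _ _ _ _ Cy) as (r & E & _).
    destruct (chain_d_finite _ _ _ _ Cy') as (r' & E' & _).
    specialize (M t Ht); cbn beta in M; rewrite E, E' in *; exact M.
- exists (g 0), 0; split; [lra|]; split; trivial.
  intros t q Ht Oq; apply on_edge_plane in Oq as ->; fold (g t).
  destruct (classic (d plane p (g t) = p_infty)) as [->|N'].
  + now destruct (d plane p (g 0)).
  + exfalso; apply N; now exists t.
Qed.

Lemma nearest_on_path u l v p :
  edge_path plane u l v ->
  exists q, on_path plane l q /\ forall q', on_path plane l q' -> Rbar_le (d plane p q) (d plane p q').
Proof.
induction 1 as [u V|u w v l A P (q2 & O2 & M2)].
- exists u; split; [exists 0; left; split; [lra|reflexivity]|].
  intros q' O; apply on_path_single in O as ->; apply Rbar_le_refl.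
- destruct (edge_path_head _ _ _ _ P) as [l' ->].
  destruct (nearest_on_edge p u w A) as (q1 & s & Hs & O1 & M1).
  destruct (Rbar_le_lt_dec (d plane p q1) (d plane p q2)) as [H|H].
  + exists q1; split; [apply on_path_cons; eauto|].
    intros q' O; apply on_path_cons in O as [(s' & Hs' & O)|O]; trivial.
    * now apply M1 with s'.
    * apply Rbar_le_trans with (d plane p q2); auto.
  + exists q2; split; [apply on_path_cons; eauto|].
    intros q' O; apply on_path_cons in O as [(s' & Hs' & O)|O]; trivial.
    * apply Rbar_le_trans with (d plane p q1); [now apply Rbar_lt_le|now apply M1 with s'].
    * auto.
Qed.

Lemma nbhd_limit (A B : R2 -> Prop) (E : R -> Prop) (r : R) :
  (forall p, exists q, B q /\ forall q', B q' -> Rbar_le (d plane p q) (d plane p q')) ->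
  (exists k, E k) -> is_glb_Rbar E r -> (forall k, E k -> within_nbhd plane k A B) ->
  within_nbhd plane r A B.
Proof.
intros N (k0 & Hk0) [_ G] H p Ap; destruct (N p) as (q & Bq & M).
exists q; split; trivial; apply G; intros k Hk.
destruct (H k Hk p Ap) as (q' & Bq' & L).
now apply Rbar_le_trans with (d plane p q'); [apply M|].
Qed.

(** The infimum of the admissible neighbourhood sizes is admissible, because each
    point has a nearest point on the other path. *)
Lemma subspace_distance_exists u l v u' l' v' K :
  edge_path plane u l v -> edge_path plane u' l' v' -> close plane l l' K ->
  exists D, subspace_distance plane l l' D.
Proof.
intros P P' C.
pose proof (Glb_Rbar_correct (close plane l l')) as G.
assert (exists r, Glb_Rbar (close plane l l') = Finite r) as [r Er].
{ destruct G as [G1 G2]; specialize (G1 K C).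
  assert (Rbar_le 0 (Glb_Rbar (close plane l l'))) as G0.
  { apply G2; intros k [H _].
    destruct (H v (on_path_end _ _ _ _ P)) as (q & _ & L).
    apply Rbar_le_trans with (d plane v q); trivial; apply d_nonneg. }
  destruct (Glb_Rbar (close plane l l')) as [r| |]; cbn in *; try contradiction; eauto. }
rewrite Er in G; exists r; split; [split|].
- apply nbhd_limit with (close plane l l'); eauto.
  + intros p; now apply nearest_on_path with u' v'.
  + now intros k [].
- apply nbhd_limit with (close plane l l'); eauto.
  + intros p; now apply nearest_on_path with u v.
  + now intros k [].
- intros k Hk; now apply G.
Qed.

Lemma within_nbhd_of_ends (F : ts_complex) u l v v' l' K :
  edge_path F u l v -> adjacent F v v' -> on_path F l' v' -> INR (path_length F l) + 1 <= K ->
  within_nbhd F K (on_path F l) (on_path F l').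
Proof.
intros P A O HK p Op; exists v'; split; trivial.
destruct (chain_to_end _ _ _ _ _ P Op) as (a & Ha & C).
apply Rbar_le_trans with (Finite (a + 1)); [|cbn; lra].
apply chain_le_d, chain_app with v; trivial; now apply chain_one, adjacent_within.
Qed.

(** A point of an edge is at distance at most [1 / 2] from one of its ends. *)
Lemma pot_on_path_le al M u l v q :
  slow al -> edge_path plane u l v -> (forall w, In w l -> pot al w <= M) ->
  on_path plane l q -> pot al q <= M + 1 / 2.
Proof.
intros Sl P; induction P as [u V|u w v l A P IH]; intros H O.
- apply on_path_single in O as ->; specialize (H u (or_introl eq_refl)); lra.
- destruct (edge_path_head _ _ _ _ P) as [l' ->].
  apply on_path_cons in O as [(s & Hs & O)|O]; trivial.
  + destruct (on_edge_within _ _ _ _ _ Hs O) as [W1 W2].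
    apply (pot_edge al) in W1, W2; trivial.
    pose proof (H u (or_introl eq_refl)).
    pose proof (H w (or_intror (or_introl eq_refl))); lra.
  + apply IH; trivial; intros x Hx; apply H; now right.
Qed.

Lemma edge_path_nth (F : ts_complex) u l v i :
  edge_path F u l v -> (i < path_length F l)%nat ->
  exists p q, nth_error l i = Some p /\ nth_error l (S i) = Some q /\ adjacent F p q.
Proof.
intros P; revert i; induction P as [u V|u w v l A P IH]; intros i Hi; [cbn in Hi; lia|].
rewrite (path_length_cons _ _ _ _ _ P) in Hi.
destruct i as [|i].
- destruct (edge_path_head _ _ _ _ P) as [l' ->]; now exists u, w.
- apply IH; lia.
Qed.

Lemma at_time_nat (F : ts_complex) u l v i :
  edge_path F u l v -> (i < path_length F l)%nat ->
  exists p, nth_error l i = Some p /\ at_time F l (INR i) p.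
Proof.
intros P Hi; destruct (edge_path_nth _ _ _ _ _ P Hi) as (p & q & Ep & Eq & A).
exists p; split; trivial; right; right; exists i, 0, p, q.
repeat split; trivial; try lra; now apply adjacent_on_edge.
Qed.

(** * The diverging geodesics *)

Lemma climb_turn j n : nth_error (climb j n) j = Some (pt E270 (0, 1)).
Proof. now induction j. Qed.

(** On the sector of angle 120 this potential is constant on the lines parallel
    to the segment from [(0, -m)] to the [m]-th vertex of the ray [E150], where it
    is [- m / 2].  The zigzag between these vertices stays next to the segment,
    whereas the potential vanishes at [(1, 0)]. *)
Definition recede : ray -> R := slopes 0 0 (- (1 / 2)) (- (1 / 2)).

Lemma slow_recede : slow recede. Proof. solve_slow. Qed.

Lemma zigzag_recedes x n w :
  In w (zigzag x n) -> pot recede w <= - ((INR (x + n) - 1) / 2).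
Proof.
assert (E : forall y m, pot recede (wide_pt y m) = - (INR (y + m) / 2)).
{ intros y m; unfold wide_pt; rewrite pot_pt by quad; rewrite plus_INR; cbn; field. }
revert x; induction n as [|n IH]; intros x; cbn [zigzag In].
- fold (wide_pt x 0); intros [<-|[]]; rewrite E; lra.
- fold (wide_pt x (S n)) (wide_pt x n); intros [<-|[<-|I]].
  + rewrite E; lra.
  + rewrite E; rewrite Nat.add_succ_r, S_INR; lra.
  + replace (x + S n)%nat with (S x + n)%nat by lia; auto.
Qed.

Lemma turn_far_from_zigzag m q :
  on_path plane (zigzag 0 m) q -> Rbar_le (INR m / 2 - 1) (d plane (pt E270 (0, 1)) q).
Proof.
intros O.
assert (B : pot recede q <= - ((INR m - 1) / 2) + 1 / 2).
{ apply (pot_on_path_le recede _ (wide_pt 0 m) (zigzag 0 m) (wide_pt (0 + m) 0)); trivial.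
  - apply slow_recede.
  - apply zigzag_steep.
  - intros w I; now apply (zigzag_recedes 0 m). }
apply Rbar_le_trans with (pot recede (pt E270 (0, 1)) - pot recede q).
- cbn [Rbar_le]; rewrite pot_pt by quad; cbn [fst snd recede slopes next] in *; lra.
- apply pot_le_d, slow_recede.
Qed.

Lemma length_for_distance k :
  exists m, k < INR m / 2 - 1.
Proof.
destruct (nat_floor (Rmax 0 k) (Rmax_l _ _)) as (n & Hn).
exists (2 * (n + 2))%nat; pose proof (Rmax_r 0 k).
rewrite mult_INR, plus_INR; cbn; lra.
Qed.

Lemma climb_at_turn m : at_time plane (climb m m) (INR m) (pt E270 (0, 1)).
Proof.
destruct (climb_gs m m) as [[P L] _].
destruct (at_time_nat _ _ _ _ m P) as (p & E & T).
- apply INR_lt; rewrite <- L, !pot_pt by quad; cbn; pose proof (pos_INR m); lra.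
- rewrite climb_turn in E; injection E as <-; trivial.
Qed.

Lemma zigzag_at_half m : (0 < m)%nat -> exists q, at_time plane (zigzag 0 m) (INR m) q.
Proof.
intros Hm; destruct (zigzag_steep m 0) as [P L].
destruct (at_time_nat _ _ _ _ m P) as (p & _ & T); eauto.
apply INR_lt; rewrite <- L, !pot_drop_wide_pt.
apply lt_0_INR in Hm; cbn; lra.
Qed.

Lemma starts_adjacent m : adjacent plane (pt E270 (INR m, 1)) (wide_pt 0 m).
Proof.
apply adjacent_sym.
replace (wide_pt 0 m) with (pt E270 (INR m, INR 0)) by (unfold wide_pt, pt; cbn; f_equal; ring).
replace 1 with (INR 0 + 1) by (cbn; ring); apply adjacent_col.
Qed.

Lemma ends_adjacent m : adjacent plane (pt E60 (1, INR m)) (wide_pt (0 + m) 0).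
Proof.
apply adjacent_sym.
replace (wide_pt (0 + m) 0) with (pt E60 (INR 0, INR m)) by (unfold wide_pt, pt; cbn; f_equal; ring).
replace 1 with (INR 0 + 1) by (cbn; ring); apply adjacent_row.
Qed.

Theorem proposition9p3 :
  (exists F : ts_complex, flat F /\ radial F /\
     forall k : R, 0 < k ->
     exists (u v u' v' : point F) (alpha beta : list (point F)) (D : R),
       gersten_short F u alpha v /\ gersten_short F u' beta v' /\
       adjacent F u u' /\ adjacent F v v' /\
       subspace_distance F alpha beta D /\ k < D)
  /\
  (exists F : ts_complex, flat F /\ radial F /\
     forall k : R,
     exists (u v u' v' : point F) (alpha beta : list (point F)),
       gersten_short F u alpha v /\ gersten_short F u' beta v' /\
       Rbar_le (d F u u') 1 /\ Rbar_le (d F v v') 1 /\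
       ~ fellow_travel F k alpha beta).
Proof.
split; exists plane; (split; [exact plane_flat|split; [exact plane_radial|]]); intros k.
- intros _; destruct (length_for_distance k) as (m & Hm).
  pose proof (climb_gs m m) as [[Pa _] Ga].
  pose proof (zigzag_steep m 0) as [Pb _].
  pose proof (starts_adjacent m) as As; pose proof (ends_adjacent m) as Ae.
  destruct (subspace_distance_exists _ _ _ _ _ _
    (INR (path_length plane (climb m m)) + INR (path_length plane (zigzag 0 m)) + 1) Pa Pb)
    as (D & HD).
  { pose proof (pos_INR (path_length plane (climb m m))).
    pose proof (pos_INR (path_length plane (zigzag 0 m))); split.
    - eapply within_nbhd_of_ends; [exact Pa|exact Ae| |lra]; now apply on_path_end in Pb.
    - eapply within_nbhd_of_ends; [exact Pb|apply adjacent_sym; exact Ae| |lra];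
      now apply on_path_end in Pa. }
  exists (pt E270 (INR m, 1)), (pt E60 (1, INR m)), (wide_pt 0 m), (wide_pt (0 + m) 0),
    (climb m m), (zigzag 0 m), D.
  repeat split; trivial; try apply HD; [apply zigzag_gs|].
  destruct HD as [[HD _] _].
  destruct (HD (pt E270 (0, 1))) as (q & Oq & L).
  { exists (INR m); apply climb_at_turn. }
  apply turn_far_from_zigzag in Oq.
  pose proof (Rbar_le_trans _ _ _ Oq L) as L'; cbn [Rbar_le] in L'; lra.
- destruct (length_for_distance (Rmax k 0)) as (m & Hm).
  pose proof (Rmax_l k 0); pose proof (Rmax_r k 0).
  exists (pt E270 (INR m, 1)), (pt E60 (1, INR m)), (wide_pt 0 m), (wide_pt (0 + m) 0),
    (climb m m), (zigzag 0 m).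
  split; [apply climb_gs|]; split; [apply zigzag_gs|].
  split; [apply chain_le_d, chain_one, adjacent_within, starts_adjacent|].
  split; [apply chain_le_d, chain_one, adjacent_within, ends_adjacent|].
  intros FT; destruct (zigzag_at_half m) as (q & Tq).
  { apply INR_lt; cbn; lra. }
  pose proof (FT _ _ _ (climb_at_turn m) Tq) as L.
  pose proof (turn_far_from_zigzag m q (ex_intro (fun t => at_time plane (zigzag 0 m) t q) (INR m) Tq)) as L0.
  pose proof (Rbar_le_trans _ _ _ L0 L) as L'; cbn [Rbar_le] in L'; lra.
Qed.
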